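(* Let $I$ and $J$ be disjoint index sets and let $\nu\in\Sigma^+(I,J)$. Then $\nu$ is bi-free infinitely divisible if and only if there is a semigroup $\{\nu_t:t\ge0\}$ of distributions in $\Sigma^+(I,J)$ such that $\nu_{s+t}=\nu_s\boxplus\boxplus\nu_t$ for all $s,t\ge0$, $\nu_1=\nu$, $\nu_0=\delta_0$, and $\lim_{t\to0}\nu_t=\delta_0$ weakly.
   Context: $\mathbb{C}\langle X_k:k\in I\sqcup J\rangle$ is the unital $*$-algebra of non-commutative polynomials with $X_k=X_k^*$, and $\Sigma^+(I,J)$ is the set of all positive unital linear functionals on it (positive: $\nu(Q^*Q)\ge0$ for all $Q$). $\delta_0$ is the functional $Q\mapsto Q(0)$ (value $1$ at $1$, value $0$ on every non-constant monomial). Weak convergence of functionals means pointwise convergence on $\mathbb{C}\langle X_k:k\in I\sqcup J\rangle$. Bi-free cumulants. A non-commutative probability space $(\mathcal{A},\varphi)$ is a unital complex algebra with a unital linear functional. For $\chi:\{1,\dots,n\}\to I\sqcup J$, call the position $k$ left if $\chi(k)\in I$ and right if $\chi(k)\in J$. If the left positions are $i_1<\dots<i_p$ and the right positions are $i_{p+1}>\dots>i_n$, let $s_\chi(k)=i_k$ and $BNC(\chi)=\{s_\chi\cdot\pi:\pi\in NC(n)\}$, where $NC(n)$ is the set of non-crossing partitions of $\{1,\dots,n\}$ and $s_\chi\cdot\pi=\{s_\chi(V):V\in\pi\}$. The bi-free cumulants $\kappa_\chi:\mathcal{A}^n\to\mathbb{C}$ are the multilinear functionals determined recursively by $$\varphi(b_1\cdots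 b_n)=\sum_{\pi\in BNC(\chi)}\ \prod_{V\in\pi}\kappa_{\chi|_V}\big((b_1,\dots,b_n)|_V\big),\qquad b_1,\dots,b_n\in\mathcal{A},$$ where for $V=\{v_1<\dots<v_k\}$ one sets $(b_1,\dots,b_n)|_V=(b_{v_1},\dots,b_{v_k})$ and $\chi|_V$ is viewed as a map on $\{1,\dots,k\}$. A two-faced family is a family $((z_i)_{i\in I},(z_j)_{j\in J})$ in $\mathcal{A}$; its distribution is the functional $P\mapsto\varphi(P(z_k:k\in I\sqcup J))$. Two two-faced families $z',z''$ in the same space are bi-free if $\kappa_\chi(z^{\epsilon_1}_{\chi(1)},\dots,z^{\epsilon_n}_{\chi(n)})=0$ for all $n\ge2$, all $\chi:\{1,\dots,n\}\to I\sqcup J$ and all non-constant $\epsilon:\{1,\dots,n\}\to\{',''\}$. The bi-free additive convolution $\mu_1\boxplus\boxplus\mu_2$ is the distribution of $((z'_i+z''_i)_{i\in I},(z'_j+z''_j)_{j\in J})$ where $z',z''$ are bi-free with distributions $\mu_1,\mu_2$; equivalently, it is the unital functional whose bi-free cumulants (of the variables $X_{\chi(1)},\dots,X_{\chi(n)}$, for all $\chi$) are the sums of those of $\mu_1$ and $\mu_2$. A distribution $\nu\in\Sigma^+(I,J)$ is bi-free infinitely divisible if for each $N\in\mathbb{N}$ there is $\nu_{1/N}\in\Sigma^+(I,J)$ with $\nu=\nu_{1/N}\boxplus\boxplus\cdots\boxplus\boxplus\nu_{1/N}$ ($N$ times). *)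

(* Defs.v *)
From HB Require Import structures.
From mathcomp Require Import all_boot all_order all_algebra finmap.
From mathcomp Require Import complex boolp reals monalg.

Set Implicit Arguments.
Unset Strict Implicit.
Unset Printing Implicit Defensive.

Import Order.TTheory GRing.Theory Num.Theory.

Local Open Scope ring_scope.

(* C<X_k : k in I |_| J>, as the monoid algebra over C = R[i] of the free      *)
(* monoid on the disjoint union I + J.                                         *)
Notation ncpoly R I J := {malg R[i][{fmonom (I + J)%type}]}.

Section Functionals.
Context (R : realType) (I J : choiceType).
Implicit Types (Q : ncpoly R I J) (nu : {scalar ncpoly R I J}).

(* Conjugate-linear and X_k1 ... X_kn |-> X_kn ... X_k1. *)
Definition ncstar Q : ncpoly R I J :=
  \sum_(w <- msupp Q) << (Q@_w)^*%C *g FMonom (rev w) >>.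

Definition nceval (A : algType R[i]) (z : I + J -> A) Q : A :=
  mmap (in_alg A) (fun w : {fmonom (I + J)%type} => \prod_(k <- w) z k) Q.

Definition delta0 Q : R[i] := nceval (fun=> 0 : R[i]^o) Q.

(* In R[i], 0 <= x means that x is real and nonnegative. *)
Definition Sigma_plus nu : Prop :=
  nu 1 = 1 /\ forall Q, 0 <= nu (ncstar Q * Q).

End Functionals.

Section BiNonCrossing.
Context (n : nat).

Definition noncrossing (pi : {set {set 'I_n}}) : bool :=
  [forall V in pi, forall W in pi,
   forall a in V, forall b in W, forall c in V, forall d in W,
   [&& (a < b)%N, (b < c)%N & (c < d)%N] ==> (V == W)].

Definition NC : {set {set {set 'I_n}}} :=
  [set pi : {set {set 'I_n}} | partition pi [set: 'I_n] & noncrossing pi].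

Context (I J : Type) (chi : 'I_n -> I + J).

Definition is_left (k : 'I_n) : bool := if chi k is inl _ then true else false.

(* i_1 < ... < i_p, then i_(p+1) > ... > i_n *)
Definition chi_order : seq 'I_n :=
  [seq k <- enum 'I_n | is_left k] ++
  rev [seq k <- enum 'I_n | ~~ is_left k].

Definition s_chi (k : 'I_n) : 'I_n := nth k chi_order k.

Definition BNC : {set {set {set 'I_n}}} :=
  [set [set s_chi @: V | V : {set 'I_n} in pi] | pi : {set {set 'I_n}} in NC].

Lemma s_chi_inj : injective s_chi.
Proof.
have sz : size chi_order = n.
  by rewrite size_cat size_rev !size_filter count_predC size_enum_ord.
have un : uniq chi_order.
  rewrite cat_uniq rev_uniq !(filter_uniq _ (enum_uniq _)) andbT /=.
  apply/hasPn => k; rewrite mem_rev mem_filter => /andP[kr _].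
  by rewrite mem_filter negb_and kr.
move=> k l /eqP; rewrite /s_chi.
rewrite [X in _ == X](set_nth_default k) ?sz// nth_uniq ?sz//.
by move/eqP/val_inj.
Qed.

Lemma BNC_partition pi : pi \in BNC -> partition pi [set: 'I_n].
Proof.
case/imsetP => rho; rewrite inE => /andP[rhoP _] ->.
have <- : [set s_chi k | k in [set: 'I_n]] = [set: 'I_n].
  by apply/eqP; rewrite eqEcard subsetT card_imset ?leqnn//; exact: s_chi_inj.
by rewrite (imset_partition _ _ s_chi_inj).
Qed.

Lemma BNC_card pi V : pi \in BNC -> V \in pi ->
  (0 < #|V| <= n)%N && ((#|V| == n) ==> (pi == [set [set: 'I_n]])).
Proof.
move=> /BNC_partition piP Vpi; rewrite card_gt0 (partition_neq0 piP Vpi) /=.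
rewrite -[X in (_ <= X)%N](card_ord n) max_card /=; apply/implyP => /eqP cV.
have VT : V = [set: 'I_n] by apply/eqP; rewrite eqEcard subsetT cardsT card_ord cV /=.
rewrite VT in Vpi; apply/eqP/setP => W; rewrite inE; apply/idP/eqP => [Wpi|->//].
apply/eqP; apply: contraT => WT.
have /trivIsetP/(_ _ _ Wpi Vpi WT) := partition_trivIset piP.
by rewrite -setI_eq0 setIT (negPf (partition_neq0 piP Wpi)).
Qed.

Lemma BNC_top : (0 < n)%N -> [set [set: 'I_n]] \in BNC.
Proof.
move=> n0; apply/imsetP; exists [set [set: 'I_n]].
  have T0 : [set: 'I_n] != set0 by rewrite -card_gt0 cardsT card_ord.
  rewrite inE /partition /trivIset /cover !big_set1 !eqxx in_set1 [set0 == _]eq_sym (negPf T0) /=.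
  by apply/forall_inP => V /set1P->; apply/forall_inP => W /set1P->;
    do 4!apply/forall_inP => ? _; rewrite eqxx implybT.
rewrite imset_set1; congr [set _]; apply/esym/eqP.
by rewrite eqEcard subsetT card_imset ?leqnn//; exact: s_chi_inj.
Qed.

End BiNonCrossing.

(* For V = {v_1 < ... < v_k}, the tuple (f v_1, ..., f v_k); enum_val lists   *)
(* the elements of V in increasing order.                                      *)
Definition restr (n : nat) (T : Type) (f : 'I_n -> T) (V : {set 'I_n}) :=
  fun i : 'I_#|V| => f (enum_val i).
Arguments restr {n T} f V i.

Section BiFree.
Context (R : realType) (I J : choiceType).

Section Cumulants.
Context (A : algType R[i]) (phi : {scalar A}).

(* The moment-cumulant formula solved for the one-block partition; m bounds   *)
(* the depth of the recursion. See [moment_cumulant].                          *)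
Fixpoint cumulant_rec (m n : nat) (chi : 'I_n -> I + J) (b : 'I_n -> A) :
    R[i] :=
  if m is m'.+1 then
    phi (\prod_(k < n) b k) -
    \sum_(pi in BNC chi | pi != [set [set: 'I_n]])
      \prod_(V in pi) cumulant_rec m' (restr chi V) (restr b V)
  else 0.

Definition bifree_cumulant (n : nat) (chi : 'I_n -> I + J) (b : 'I_n -> A) :
    R[i] := cumulant_rec n chi b.

Lemma cumulant_rec_stable (m1 m2 n : nat) (chi : 'I_n -> I + J) b :
  (0 < n <= m1)%N -> (n <= m2)%N ->
  cumulant_rec m1 chi b = cumulant_rec m2 chi b.
Proof.
elim: m1 m2 n chi b => [|m1 IH] [|m2] n chi b /andP[n0 nm1] nm2 /=;
  do ?by move: (leq_trans n0 nm1) (leq_trans n0 nm2).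
congr (_ - _); apply: eq_bigr => pi /andP[piB piN]; apply: eq_bigr => V Vpi.
have /andP[/andP[V0]] := BNC_card piB Vpi.
rewrite leq_eqVlt (negPf piN) implybF => /orP[->//|Vn _].
have [Vm1 Vm2] : (#|V| <= m1)%N /\ (#|V| <= m2)%N.
  by split; rewrite -ltnS (leq_trans Vn).
by apply: IH Vm2; rewrite V0 Vm1.
Qed.

Lemma moment_cumulant (n : nat) (chi : 'I_n -> I + J) (b : 'I_n -> A) :
  phi 1 = 1 ->
  phi (\prod_(k < n) b k) =
  \sum_(pi in BNC chi) \prod_(V in pi) bifree_cumulant (restr chi V) (restr b V).
Proof.
move=> phi1; case: n chi b => [|n] chi b.
  have B0 : BNC chi = [set set0].
    apply/setP => pi; rewrite inE; apply/idP/eqP => [/BNC_partition|->].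
      rewrite (_ : [set: 'I_0] = set0) ?partition_set0; first by move/eqP.
      by apply/setP => -[].
    apply/imsetP; exists set0; last by rewrite imset0.
    rewrite inE (_ : [set: 'I_0] = set0) ?partition_set0 ?eqxx //=.
      by apply/forall_inP => V; rewrite inE.
    by apply/setP => -[].
  by rewrite B0 big_set1 big_set0 big_ord0.
rewrite (bigD1 _ (BNC_top chi (ltn0Sn n))) /= big_set1.
have -> : bifree_cumulant (restr chi [set: 'I_n.+1]) (restr b [set: 'I_n.+1]) =
    bifree_cumulant chi b.
  have cast m (f : 'I_m -> 'I_n.+1) : m = n.+1 -> (forall i, val (f i) = val i) ->
      bifree_cumulant (fun i => chi (f i)) (fun i => b (f i)) =
      bifree_cumulant chi b.
    move=> mn; subst m => fE.
    by congr bifree_cumulant; apply/funext => i; rewrite (_ : f i = i)//;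
      apply: val_inj.
  apply: (cast _ (@enum_val _ (mem [set: 'I_n.+1]))); first by rewrite cardsT card_ord.
  move=> i; rewrite (enum_val_nth ord0) enum_setT -enumT /= nth_enum_ord//.
  by rewrite -[X in (_ < X)%N]card_ord -cardsT ltn_ord.
rewrite [bifree_cumulant chi b]/bifree_cumulant [cumulant_rec _ _ _]/=.
rewrite -[LHS](subrK (\sum_(pi in BNC chi | pi != [set [set: 'I_n.+1]])
      \prod_(V in pi) cumulant_rec n (restr chi V) (restr b V))).
congr (_ + _); apply: eq_bigr => pi /andP[piB piN]; apply: eq_bigr => V Vpi.
have /andP[/andP[V0]] := BNC_card piB Vpi.
rewrite leq_eqVlt (negPf piN) implybF => /orP[->//|Vn _].
by apply: cumulant_rec_stable; rewrite ?V0.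
Qed.

Definition bifree (z1 z2 : I + J -> A) : Prop :=
  forall (n : nat) (chi : 'I_n -> I + J) (eps : 'I_n -> bool),
    (2 <= n)%N -> (exists i j, eps i != eps j) ->
    bifree_cumulant chi
      (fun k => if eps k then z2 (chi k) else z1 (chi k)) = 0.

Definition distribution (z : I + J -> A) (Q : ncpoly R I J) : R[i] :=
  phi (nceval z Q).

End Cumulants.

(* mu = mu1 [+][+] mu2 *)
Definition bifree_conv (mu1 mu2 mu : {scalar ncpoly R I J}) : Prop :=
  exists (A : algType R[i]) (phi : {scalar A}) (z1 z2 : I + J -> A),
    [/\ phi 1 = 1,
        bifree phi z1 z2,
        mu1 =1 distribution phi z1,
        mu2 =1 distribution phi z2 &
        mu =1 distribution phi (fun k => z1 k + z2 k)].

(* [bifree_conv_pow mu N nu]: nu = mu [+][+] ... [+][+] mu (N times, N >= 1) *)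
Inductive bifree_conv_pow (mu : {scalar ncpoly R I J}) :
    nat -> {scalar ncpoly R I J} -> Prop :=
| bifree_conv_pow1 (nu : {scalar ncpoly R I J}) : nu =1 mu -> bifree_conv_pow mu 1 nu
| bifree_conv_powS N (rho nu : {scalar ncpoly R I J}) : bifree_conv_pow mu N rho ->
    bifree_conv rho mu nu -> bifree_conv_pow mu N.+1 nu.

Definition bifree_infdiv (nu : {scalar ncpoly R I J}) : Prop :=
  forall N : nat, (1 <= N)%N ->
    exists2 mu : {scalar ncpoly R I J}, Sigma_plus mu & bifree_conv_pow mu N nu.

End BiFree.

(* Main.v *)
From HB Require Import structures.
Require Import Defs.
From mathcomp Require Import all_boot all_order all_algebra finmap.
From mathcomp Require Import complex spectral.
From mathcomp Require Import all_classical all_reals all_analysis.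
From mathcomp Require Import -(notations) monalg.
From mathcomp Require Import fintype finset ring.

(** Write [kappa] for the bi-free cumulants of [nu], seen as a function on
    words in the letters I + J. The convolution adds cumulants
    ([conv_cumulants], [cumulants_conv]), so the candidate for [nu_t] is the
    functional with cumulants [t * kappa] ([scaled_law]). The semigroup
    law, the values at t = 0 and t = 1 and the continuity at 0 are then formal: a
    moment is a polynomial in t, whose constant term is 0 unless the word is
    empty. Conversely, [nu_(1/N)] is an N-th root of [nu_1]. The content of the
    theorem is that [nu_t] is positive.

    Infinite divisibility enters through a limit. If [mu_N] is an N-th root of
    [nu], then [N * mu_N(w)] tends to [kappa(w)] for every non-empty word w,
    because a partition with at least two blocks contributes O(1/N^2) to
    [mu_N(w)]. Hence the kernel (u, v) |-> kappa(u^* v) is positive on non-empty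
    words ([infdiv_cumulants_psd]), and so is t times this kernel for t >= 0.

    It remains to see that cumulants K that are positive in this sense, and
    real on single letters, belong to a positive functional ([vac_positive]).
    The reason is a Fock space. Read a word from right to left, keeping the
    list, ordered from left to right, of the blocks that are still open: a left
    letter can only start a new leftmost block or join the leftmost open block,
    a right letter does the same at the other end, and after that the block of
    the letter is left open or closed, a closed block contributing its
    cumulant. These four choices are the creation, preservation, annihilation
    and scalar parts of an operator [step] on the span of the lists of words,
    and the moment of a word is the vacuum expectation of the product of its
    operators ([open_sum_vac], [moment_of_vac]). For the inner product given by
    products of K(u^* v), which is positive by the Schur product theorem
    ([psd_on_mul], [fock_kernel_psd]), each operator is symmetric ([step_sym]);
    therefore the moment of u^* v is the inner product of the vectors that u
    and v create from the vacuum.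

    The same recursion makes the vacuum expectation visibly multilinear
    ([sum_vac_lifts]), which gives the additivity of cumulants under the sum of
    bi-free families. *)

Set Implicit Arguments.
Unset Strict Implicit.
Unset Printing Implicit Defensive.

Import Order.TTheory GRing.Theory Num.Theory.
Import numFieldNormedType.Exports.

Local Open Scope ring_scope.

(** * Non-crossing partitions of a partially read word *)

Section OpenPartitions.
Context (n : nat).
Implicit Types (lt : rel 'I_n) (sigma : {set {set 'I_n}}) (s : seq {set 'I_n}).

Definition noncrossing_for lt sigma : Prop :=
  forall V W, V \in sigma -> W \in sigma -> forall a b c d,
    a \in V -> b \in W -> c \in V -> d \in W ->
    lt a b -> lt b c -> lt c d -> V = W.

(** The positions at least [m] have been read, and [s] lists the open blocks, as
    the sets of their read positions. [sigma] is a partition of the unread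
    positions and of the positions in open blocks, that is, a partition of the
    whole word from which the closed blocks have been deleted. Every open block
    still has to receive an unread position, and two open blocks must not be
    merged by later letters. *)
Record open_partition lt (m : nat) s sigma : Prop := OpenPartition {
  op_cover : forall k, (exists2 B, B \in sigma & k \in B) <->
                       (k < m)%N \/ (exists2 V, V \in s & k \in V);
  op_triv : forall B B', B \in sigma -> B' \in sigma ->
              forall k, k \in B -> k \in B' -> B = B';
  op_neq0 : forall B, B \in sigma -> exists k, k \in B;
  op_nc : noncrossing_for lt sigma;
  op_ext : forall V, V \in s -> exists2 B, B \in sigma &
              V \subset B /\ exists2 p : 'I_n, p \in B & (p < m)%N;
  op_sep : forall B V V', B \in sigma -> V \in s -> V' \in s ->
              forall a b, a \in V -> a \in B -> b \in V' -> b \in B -> V = V'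
}.

(** The open blocks do not interleave: each lies entirely before the next one for
    [lt]. This is what makes only the two extreme ones accessible. *)
Record ordered_state lt (m : nat) s : Prop := OrderedState {
  os_neq0 : forall V, V \in s -> exists k, k \in V;
  os_ge : forall V, V \in s -> forall k : 'I_n, k \in V -> (m <= k)%N;
  os_pairwise : pairwise
    (fun V W : {set 'I_n} => [forall a in V, forall b in W, lt a b]) s
}.

(** Reading from the last position down, the unread positions always lie outside
    the [lt]-interval spanned by the read ones. *)
Record outside_order lt : Prop := OutsideOrder {
  oo_irr : irreflexive lt;
  oo_trans : transitive lt;
  oo_total : forall a b, a != b -> lt a b || lt b a;
  oo_out : forall p k k' : 'I_n, (p < k)%N -> (p < k')%N -> lt p k = lt p k'
}.

Lemma os_pairwiseP lt (V : {set 'I_n}) s :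
  reflect (forall W, W \in s -> forall a b, a \in V -> b \in W -> lt a b)
    (all (fun W : {set 'I_n} => [forall a in V, forall b in W, lt a b]) s).
Proof.
apply: (iffP allP) => H W /H.
  by move=> /forall_inP H' a b /H'/forall_inP H'' /H''.
move=> H'; apply/forall_inP => a aV; apply/forall_inP => b; exact: H'.
Qed.

Section Weighted.
Context (C : numClosedFieldType) (W : {set 'I_n} -> C).

Definition open_sum lt m s : C :=
  \sum_(sigma | `[< open_partition lt m s sigma >]) \prod_(B in sigma) W B.

Section LeftStep.
Context (lt : rel 'I_n) (ltO : outside_order lt) (x : 'I_n).
Context (x_lt : forall k : 'I_n, (x < k)%N -> lt x k).

Let asym a b : lt a b -> lt b a -> False.
Proof. by move=> ab ba; have := oo_trans ltO ab ba; rewrite (oo_irr ltO). Qed.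

(** First way of reading the letter at [x]: it starts a block that stays open. The
    partition does not change, only the bookkeeping does. *)
Lemma op_open_new s sigma : ordered_state lt x.+1 s ->
  open_partition lt x ([set x] :: s) sigma <->
  open_partition lt x.+1 s sigma /\
  exists2 B, B \in sigma & [/\ x \in B, exists2 p : 'I_n, p \in B & (p < x)%N &
     forall V k, V \in s -> k \in V -> k \notin B].
Proof.
move=> oss; split.
- move=> op.
  have [B Bs [xB [p pB px]]] := op_ext op (mem_head _ _).
  rewrite sub1set in xB.
  have sepB V k : V \in s -> k \in V -> k \notin B.
    move=> Vs kV; apply/negP => kB.
    have E : [set x] = V.
      by apply: (op_sep op Bs _ _ (set11 x) xB kV kB); rewrite ?mem_head// inE Vs orbT.
    by have := os_ge oss Vs (k := x); rewrite -E set11 ltnn => /(_ isT).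
  split; last by exists B => //; split=> //; exists p.
  split.
  + move=> k; rewrite (op_cover op); split.
      move=> [kx|[V]]; first by left; exact: ltnW.
      rewrite inE => /predU1P[->|Vs kV]; last by right; exists V.
      by rewrite inE => /eqP->; left.
    move=> [|[V Vs kV]]; last by right; exists V; rewrite // inE Vs orbT.
    rewrite ltnS leq_eqVlt => /predU1P[/val_inj->|]; last by left.
    by right; exists [set x]; rewrite ?mem_head ?set11.
  + exact: op_triv op.
  + exact: op_neq0 op.
  + exact: op_nc op.
  + move=> V Vs; have := op_ext op (V := V); rewrite inE Vs orbT => /(_ isT).
    move=> [B' B's [VB [q qB qx]]]; exists B' => //; split=> //.
    by exists q => //; exact: ltnW.
  + move=> B' V V' B's Vs V's a b; apply: (op_sep op B's); by rewrite inE ?Vs ?V's orbT.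
- move=> [op [B Bs [xB [p pB px] sepB]]]; split.
  + move=> k; rewrite (op_cover op); split.
      move=> [|[V Vs kV]]; last by right; exists V; rewrite // inE Vs orbT.
      rewrite ltnS leq_eqVlt => /predU1P[/val_inj->|]; last by left.
      by right; exists [set x]; rewrite ?mem_head ?set11.
    move=> [kx|[V]]; first by left; exact: ltnW.
    rewrite inE => /predU1P[->|Vs kV]; last by right; exists V.
    by rewrite inE => /eqP->; left.
  + exact: op_triv op.
  + exact: op_neq0 op.
  + exact: op_nc op.
  + move=> V; rewrite inE => /predU1P[->|Vs].
      by exists B; rewrite ?sub1set //; split=> //; exists p.
    have [B' B's [VB [q qB qx]]] := op_ext op Vs; exists B' => //; split=> //.
    exists q => //; move: qx; rewrite ltnS leq_eqVlt => /predU1P[/val_inj qx|//].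
    have [k kV] := os_neq0 oss Vs.
    rewrite qx in qB; move: (sepB _ _ Vs kV).
    by rewrite -(op_triv op B's Bs qB xB) (subsetP VB _ kV).
  + move=> B' V V' B's; rewrite !inE => /predU1P[->|Vs] /predU1P[->|V's] a b //.
    * rewrite inE => /eqP-> xB' bV' bB'; move: (sepB _ _ V's bV').
      by rewrite (op_triv op Bs B's xB xB') bB'.
    * move=> aV aB'; rewrite inE => /eqP-> xB'; move: (sepB _ _ Vs aV).
      by rewrite (op_triv op Bs B's xB xB') aB'.
    * exact: (op_sep op B's).
Qed.

(** Second way: [x] joins the leftmost open block, which stays open; again the
    partition does not change. *)
Lemma op_open_join V s sigma : ordered_state lt x.+1 (V :: s) ->
  open_partition lt x ((x |: V) :: s) sigma <->
  open_partition lt x.+1 (V :: s) sigma /\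
  exists2 B, B \in sigma &
    [/\ x \in B, exists2 p : 'I_n, p \in B & (p < x)%N & V \subset B].
Proof.
move=> oss.
have [v vV] := os_neq0 oss (mem_head _ _).
have xV' V' : V' \in s -> x \notin V'.
  move=> V's; apply/negP => xV'.
  by have := os_ge oss (V := V') _ xV'; rewrite inE V's orbT ltnn => /(_ isT).
have cov (k : 'I_n) : (k < x)%N \/ (exists2 V0, V0 \in (x |: V) :: s & k \in V0) <->
    (k < x.+1)%N \/ (exists2 V0, V0 \in V :: s & k \in V0).
  split.
    move=> [kx|[V0]]; first by left; exact: ltnW.
    rewrite inE => /predU1P[->|Vs kV].
      rewrite !inE => /predU1P[->|kV]; first by left.
      by right; exists V => //; rewrite mem_head.
    by right; exists V0 => //; rewrite inE Vs orbT.
  move=> [|[V0 Vs kV]].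
    rewrite ltnS leq_eqVlt => /predU1P[/val_inj->|]; last by left.
    by right; exists (x |: V); rewrite ?mem_head ?setU11.
  move: Vs kV; rewrite inE => /predU1P[->|Vs] kV.
    by right; exists (x |: V); rewrite ?mem_head //= inE kV orbT.
  by right; exists V0; rewrite // inE Vs orbT.
split.
- move=> op.
  have [B Bs [xVB [p pB px]]] := op_ext op (mem_head _ _).
  have xB : x \in B by apply: (subsetP xVB); rewrite setU11.
  have VB : V \subset B by apply: subset_trans xVB; exact: subsetUr.
  split; last by exists B => //; split=> //; exists p.
  split.
  + by move=> k; rewrite (op_cover op); exact: cov.
  + exact: op_triv op.
  + exact: op_neq0 op.
  + exact: op_nc op.
  + move=> V0; rewrite inE => /predU1P[->|V0s].
      by exists B => //; split=> //; exists p => //; exact: ltnW.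
    have := op_ext op (V := V0); rewrite inE V0s orbT => /(_ isT).
    move=> [B' B's [V0B [q qB qx]]]; exists B' => //; split=> //.
    by exists q => //; exact: ltnW.
  + have sep V' : V' \in s -> forall B' a b, B' \in sigma ->
        a \in V -> a \in B' -> b \in V' -> b \in B' -> False.
      move=> V's B' a b B's aV aB' bV' bB'.
      have E : x |: V = V'.
        apply: (op_sep op B's _ _ _ aB' bV' bB').
        + by rewrite mem_head.
        + by rewrite inE V's orbT.
        + by rewrite inE aV orbT.
      by move: (xV' _ V's); rewrite -E setU11.
    move=> B' V1 V2 B's; rewrite !inE => /predU1P[->|V1s] /predU1P[->|V2s] a b //.
    * by move=> aV aB bV bB; case: (sep _ V2s _ _ _ B's aV aB bV bB).
    * by move=> aV aB bV bB; case: (sep _ V1s _ _ _ B's bV bB aV aB).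
    * by apply: (op_sep op B's); rewrite inE ?V1s ?V2s orbT.
- move=> [op [B Bs [xB [p pB px] VB]]].
  have sep V' : V' \in s -> forall b, b \in V' -> b \in B -> V = V'.
    move=> V's b bV' bB; apply: (op_sep op Bs _ _ vV (subsetP VB _ vV) bV' bB).
      by rewrite mem_head.
    by rewrite inE V's orbT.
  have Vns : V \notin s.
    apply/negP => Vs; have /os_pairwiseP/(_ _ Vs _ _ vV vV) : 
        all (fun W : {set 'I_n} => [forall a in V, forall b in W, lt a b]) s.
      by have := os_pairwise oss; rewrite /= => /andP[].
    by rewrite (oo_irr ltO).
  split.
  + by move=> k; rewrite (op_cover op); apply: iff_sym; exact: cov.
  + exact: op_triv op.
  + exact: op_neq0 op.
  + exact: op_nc op.
  + move=> V0; rewrite inE => /predU1P[->|V0s].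
      by exists B => //; split; [rewrite subUset sub1set xB|exists p].
    have := op_ext op (V := V0); rewrite inE V0s orbT => /(_ isT).
    move=> [B' B's [V0B [q qB qx]]]; exists B' => //; split=> //.
    exists q => //; move: qx; rewrite ltnS leq_eqVlt => /predU1P[/val_inj qx|//].
    rewrite qx in qB; have [k kV0] := os_neq0 oss (V := V0) ltac:(by rewrite inE V0s orbT).
    have E := op_triv op B's Bs qB xB; rewrite E in V0B.
    by move: Vns; rewrite (sep _ V0s _ kV0 (subsetP V0B _ kV0)) V0s.
  + have sepx V' : V' \in s -> forall B' a b, B' \in sigma ->
        a \in x |: V -> a \in B' -> b \in V' -> b \in B' -> False.
      move=> V's B' a b B's aV aB' bV' bB'.
      have aB : a \in B.
        by move: aV; rewrite !inE => /predU1P[->//|]; exact: (subsetP VB).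
      rewrite (op_triv op B's Bs aB' aB) in bB'.
      by move: Vns; rewrite (sep _ V's _ bV' bB') V's.
    move=> B' V1 V2 B's; rewrite !inE => /predU1P[->|V1s] /predU1P[->|V2s] a b //.
    * by move=> aV aB bV bB; case: (sepx _ V2s _ _ _ B's aV aB bV bB).
    * by move=> aV aB bV bB; case: (sepx _ V1s _ _ _ B's bV bB aV aB).
    * by apply: (op_sep op B's); rewrite inE ?V1s ?V2s orbT.
Qed.


(** Third and fourth ways: the block [B0] of [x] is closed and leaves the
    partition. Here [sb] is the state before and [s] the state after; the lemma
    covers both B0 = {x}, with s = sb, and B0 = x + V, where V is the head of
    [sb] and [s] its tail. Putting [B0] back creates no crossing because [B0] is
    consecutive among the remaining positions. *)
Lemma op_close_block s (B0 : {set 'I_n}) (sb : seq {set 'I_n}) sigma :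
  ordered_state lt x.+1 sb ->
  (forall V, V \in s -> V \in sb) ->
  x \in B0 -> (forall k, k \in B0 -> (x <= k)%N) ->
  (forall k, (k \in B0) || has (fun V : {set 'I_n} => k \in V) s =
             (k == x) || has (fun V : {set 'I_n} => k \in V) sb) ->
  (forall V, V \in sb -> V \notin s -> V \subset B0) ->
  (forall V, V \in sb -> V \notin s ->
     forall V', V' \in sb -> V' \notin s -> V = V') ->
  (forall V, V \in s -> forall a b, a \in B0 -> b \in V -> lt a b) ->
  B0 \notin sigma ->
  open_partition lt x s sigma <-> open_partition lt x.+1 sb (B0 |: sigma).
Proof.
move=> oss ssb xB0 B0ge cov newV new1 B0s B0n.
have covP k : k \in B0 \/ (exists2 V, V \in s & k \in V) <->
              k = x \/ exists2 V, V \in sb & k \in V.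
  have := cov k; case: (k \in B0) => /= /esym E; split.
  - by move: E => /orP[/eqP|/hasP]; [left|right].
  - by move=> _; left.
  - move=> [//|[V Vs kV]].
    have : has (fun V : {set 'I_n} => k \in V) s by apply/hasP; exists V.
    by rewrite -E => /orP[/eqP|/hasP]; [left|right].
  - move=> H; right; apply/hasP; rewrite -E; apply/orP.
    by move: H => [->|/hasP]; [left|right].
have B0V V k : V \in s -> k \in B0 -> k \notin V.
  move=> Vs kB; apply/negP => kV; have := B0s _ Vs _ _ kB kV.
  by rewrite (oo_irr ltO).
split.
- move=> op.
  have disj B k : B \in sigma -> k \in B -> k \in B0 -> False.
    move=> Bs kB kB0.
    have [|[V Vs kV]] := (op_cover op k).1 (ex_intro2 _ _ B Bs kB).
      by rewrite ltnNge (B0ge _ kB0).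
    by move: (B0V _ _ Vs kB0); rewrite kV.
  split.
  + move=> k; split.
      move=> [B]; rewrite !inE => /predU1P[->|Bs] kB.
        have [->|] := (covP k).1 (or_introl kB); [by left|by right].
      have [kx|[V Vs kV]] := (op_cover op k).1 (ex_intro2 _ _ B Bs kB).
        by left; exact: ltnW.
      by right; exists V => //; exact: ssb.
    have old : (k < x)%N \/ (exists2 V, V \in s & k \in V) ->
        exists2 B, B \in B0 |: sigma & k \in B.
      by move=> /(op_cover op k).2[B Bs kB]; exists B => //; rewrite !inE Bs orbT.
    have new : k = x \/ (exists2 V, V \in sb & k \in V) ->
        exists2 B, B \in B0 |: sigma & k \in B.
      by move=> /(covP k).2[kB|?]; [exists B0; rewrite ?setU11|apply: old; right].
    move=> [|?]; last by apply: new; right.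
    rewrite ltnS leq_eqVlt => /predU1P[/val_inj ?|?]; first by apply: new; left.
    by apply: old; left.
  + move=> B B'; rewrite !inE => /predU1P[->|Bs] /predU1P[->|B's] k //.
    * by move=> kB0 kB; case: (disj _ _ B's kB kB0).
    * by move=> kB kB0; case: (disj _ _ Bs kB kB0).
    * exact: (op_triv op).
  + move=> B; rewrite !inE => /predU1P[->|Bs]; first by exists x.
    exact: (op_neq0 op).
  + (* the points of B0 are consecutive among the old points and those of s *)
    have pos B b : B \in sigma -> b \in B -> (b < x)%N \/ forall a, a \in B0 -> lt a b.
      move=> Bs bB; have [|[V Vs bV]] := (op_cover op b).1 (ex_intro2 _ _ B Bs bB).
        by left.
      by right=> a aB0; exact: (B0s _ Vs).
    have B0out (p a a' : 'I_n) : (p < x)%N -> a \in B0 -> a' \in B0 -> lt p a = lt p a'.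
      by move=> px aB aB'; apply: (oo_out ltO); apply: (leq_trans px); exact: B0ge.
    move=> V V'; rewrite !inE => /predU1P[->|Vs] /predU1P[->|V's] a b c d //.
    * move=> aB bB cB dB ab bc cd; exfalso.
      have [bx|lb] := pos _ _ V's bB; last exact: (asym bc (lb _ cB)).
      by move: bc; rewrite -(B0out _ a c)// => /(asym ab).
    * move=> aB bB cB dB ab bc cd; exfalso.
      have [cx|lc] := pos _ _ Vs cB; last exact: (asym cd (lc _ dB)).
      by move: cd; rewrite -(B0out _ b d)// => /(asym bc).
    * exact: (op_nc op).
  + move=> V Vs; have [Vin|Vnin] := boolP (V \in s).
      have [B Bs [VB [p pB px]]] := op_ext op Vin.
      by exists B; rewrite ?inE ?Bs ?orbT//; split=> //; exists p => //; exact: ltnW.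
    exists B0; first by rewrite setU11.
    by split; [exact: newV|exists x].
  + move=> B V V'; rewrite !inE => /predU1P[->|Bs] Vs V's a b aV aB bV bB.
      apply: new1 => //; apply/negP => Vin.
        by move: (B0V _ _ Vin aB); rewrite aV.
      by move: (B0V _ _ Vin bB); rewrite bV.
    have ins U k : U \in sb -> k \in U -> k \in B -> U \in s.
      move=> Us kU kB; apply: contraT => Uns.
      by case: (disj _ _ Bs kB); exact: (subsetP (newV _ Us Uns)).
    exact: (op_sep op Bs (ins _ _ Vs aV aB) (ins _ _ V's bV bB) aV aB bV bB).
- move=> op.
  have disj B k : B \in sigma -> k \in B -> k \in B0 -> False.
    move=> Bs kB kB0; move: B0n.
    by rewrite (op_triv op _ _ kB0 kB) ?setU11// ?Bs// inE Bs orbT.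
  have sS B : B \in sigma -> B \in B0 |: sigma by rewrite !inE => ->; rewrite orbT.
  split.
  + move=> k; split.
      move=> [B Bs kB].
      have [kx|H] := (op_cover op k).1 (ex_intro2 _ _ B (sS _ Bs) kB).
        move: kx; rewrite ltnS leq_eqVlt => /predU1P[/val_inj kx|]; last by left.
        by case: (disj _ _ Bs kB); rewrite kx.
      have [kB0|] := (covP k).2 (or_intror H); last by right.
      by case: (disj _ _ Bs kB kB0).
    have key : (k < x.+1)%N \/ (exists2 V, V \in sb & k \in V) -> k \notin B0 ->
        exists2 B, B \in sigma & k \in B.
      move=> /(op_cover op k).2[B + kB] kB0; rewrite !inE => /predU1P[E|Bs].
        by move: kB0; rewrite -E kB.
      by exists B.
    move=> [kx|[V Vs kV]]; apply: key.
    * by left; exact: ltnW.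
    * by apply/negP => /B0ge; rewrite leqNgt kx.
    * by right; exists V => //; exact: ssb.
    * by apply/negP => kB0; move: (B0V _ _ Vs kB0); rewrite kV.
  + by move=> B B' Bs B's; apply: (op_triv op); exact: sS.
  + by move=> B Bs; apply: (op_neq0 op); exact: sS.
  + by move=> V V' Vs V's; apply: (op_nc op); exact: sS.
  + move=> V Vs; have [B + [VB [p pB px]]] := op_ext op (ssb _ Vs).
    have [k kV] := os_neq0 oss (ssb _ Vs).
    rewrite !inE => /predU1P[E|Bs].
      by move: (B0V V k Vs); rewrite -E (subsetP VB _ kV) kV => /(_ isT).
    exists B => //; split=> //; exists p => //.
    move: px; rewrite ltnS leq_eqVlt => /predU1P[/val_inj px|//].
    by case: (disj _ _ Bs pB); rewrite px.
  + by move=> B V V' Bs Vs V's; apply: (op_sep op); [exact: sS|exact: ssb|exact: ssb].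
Qed.

Lemma op_close_single s sigma : ordered_state lt x.+1 s -> [set x] \notin sigma ->
  open_partition lt x s sigma <-> open_partition lt x.+1 s ([set x] |: sigma).
Proof.
move=> oss xs; apply: op_close_block => //.
- by rewrite set11.
- by move=> k; rewrite inE => /eqP->.
- by move=> k; rewrite inE.
- by move=> V ->.
- by move=> V ->.
- move=> V Vs a b; rewrite inE => /eqP-> bV; apply: x_lt.
  exact: (os_ge oss Vs).
Qed.

Lemma op_close_join V s sigma : ordered_state lt x.+1 (V :: s) ->
  x |: V \notin sigma ->
  open_partition lt x s sigma <->
  open_partition lt x.+1 (V :: s) ((x |: V) |: sigma).
Proof.
move=> oss xs.
have ltV W0 : W0 \in s -> forall a b, a \in V -> b \in W0 -> lt a b.
  by apply/os_pairwiseP; have := os_pairwise oss; rewrite /= => /andP[].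
apply: op_close_block => //.
- by move=> U Us; rewrite inE Us orbT.
- by rewrite setU11.
- move=> k; rewrite !inE => /predU1P[->//|kV]; apply: ltnW.
  by apply: (os_ge oss (V := V)); rewrite ?mem_head.
- by move=> k; rewrite !inE /= orbA.
- move=> U; rewrite inE => /predU1P[->|->//] _; exact: subsetUr.
- by move=> U; rewrite inE => /predU1P[->|->//] _ U'; rewrite inE => /predU1P[->|->].
- move=> U Us a b; rewrite !inE => /predU1P[-> bU|aV bU]; last exact: (ltV U).
  by apply: x_lt; apply: (os_ge oss (V := U)); rewrite // inE Us orbT.
Qed.


Lemma sum_close (P1 P2 : {set {set 'I_n}} -> Prop) (B0 : {set 'I_n}) :
  (forall sigma, P1 sigma -> B0 \notin sigma) ->
  (forall sigma, B0 \notin sigma -> P1 sigma <-> P2 (B0 |: sigma)) ->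
  \sum_(sigma | `[< P2 sigma >] && (B0 \in sigma)) \prod_(B in sigma) W B =
  W B0 * \sum_(sigma | `[< P1 sigma >]) \prod_(B in sigma) W B.
Proof.
move=> P1n P12.
rewrite (reindex_onto (fun sigma => B0 |: sigma) (fun sigma => sigma :\ B0)) /=; last first.
  by move=> sigma /andP[_ B0s]; rewrite setD1K.
rewrite big_distrr /=; apply: eq_big => sigma.
  apply/andP/idP => [[/andP[/asboolP P2s _] /eqP E]|/asboolP P1s].
    apply/asboolP/P12 => //; rewrite -E !inE eqxx //.
  have B0n := P1n _ P1s; split; last by rewrite setU1K.
  by rewrite setU11 andbT; apply/asboolP; apply/P12.
move=> /andP[_ /eqP E]; rewrite big_setU1 //= -E !inE eqxx //.
Qed.

Lemma op_notin s (B0 : {set 'I_n}) sigma : x \in B0 ->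
  (forall V, V \in s -> forall k : 'I_n, k \in V -> (x < k)%N) ->
  open_partition lt x s sigma -> B0 \notin sigma.
Proof.
move=> xB0 ge op; apply/negP => B0s.
have [|[V Vs xV]] := (op_cover op x).1 (ex_intro2 _ _ B0 B0s xB0).
  by rewrite ltnn.
by have := ge _ Vs _ xV; rewrite ltnn.
Qed.

Lemma op_block s sigma : open_partition lt x.+1 s sigma ->
  exists2 B, B \in sigma & x \in B.
Proof. by move=> op; apply/(op_cover op); left. Qed.

Lemma op_single s sigma B : open_partition lt x.+1 s sigma ->
  B \in sigma -> x \in B -> 
  (forall V k, V \in s -> k \in V -> k \notin B) ->
  ~ (exists2 p : 'I_n, p \in B & (p < x)%N) -> B = [set x].
Proof.
move=> op Bs xB sepB noB; apply/setP => k; rewrite inE; apply/idP/eqP => [kB|->//].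
have [kx|[V Vs kV]] := (op_cover op k).1 (ex_intro2 _ _ B Bs kB).
  move: kx; rewrite ltnS leq_eqVlt => /predU1P[/val_inj//|kx].
  by case: noB; exists k.
by move: (sepB _ _ Vs kV); rewrite kB.
Qed.

(** If the block of [x] meets an open block, it is the leftmost one: to reach a
    later open block it would have to cross the block of the head, which must
    still leave the interval of the read positions. *)
Lemma op_meets_head V s sigma B : ordered_state lt x.+1 (V :: s) ->
  open_partition lt x.+1 (V :: s) sigma -> B \in sigma -> x \in B ->
  (V \subset B /\ forall V', V' \in s -> forall k, k \in V' -> k \notin B) \/
  forall V' k, V' \in V :: s -> k \in V' -> k \notin B.
Proof.
move=> oss op Bs xB.
have [[V' [k [V's kV' kB]]]|no] :=
  pselect (exists V' k, [/\ V' \in V :: s, k \in V' & k \in B]); last first.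
  by right=> V' k V's kV'; apply/negP => kB; apply: no; exists V', k.
have ltV W0 : W0 \in s -> forall a b, a \in V -> b \in W0 -> lt a b.
  by apply/os_pairwiseP; have := os_pairwise oss; rewrite /= => /andP[].
have [v vV] := os_neq0 oss (mem_head _ _).
have {V' k V's kV' kB}VB : V \subset B.
  move: V's; rewrite inE => /predU1P[E|V's].
    rewrite E in kV'.
    have [B' B's [VB' _]] := op_ext op (mem_head _ _).
    by rewrite (op_triv op Bs B's kB (subsetP VB' _ kV')).
  (* The head is open, so its block leaves the processed interval and would
     cross a block joining x to a later open block. *)
  have V'Vs : V' \in V :: s by rewrite inE V's orbT.
  have [B0 B0s [VB0 [p pB0]]] := op_ext op (mem_head _ _).
  rewrite ltnS leq_eqVlt => /predU1P[/val_inj px|px].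
    by rewrite px in pB0; rewrite -(op_triv op B0s Bs pB0 xB).
  have vB0 := subsetP VB0 _ vV.
  have xv : lt x v by apply/x_lt/(os_ge oss (mem_head _ _)).
  have vk := ltV _ V's _ _ vV kV'.
  have kx : (x < k)%N by exact: (os_ge oss V'Vs).
  have pnx : p != x by apply/eqP => E; rewrite E ltnn in px.
  have pnk : p != k by apply/eqP => E; move: (ltn_trans px kx); rewrite E ltnn.
  have [pltx|/negP npx] := boolP (lt p x).
    by rewrite -(op_nc op B0s Bs pB0 xB vB0 kB pltx xv vk).
  have kp : lt k p.
    have := oo_total ltO pnk; rewrite (oo_out ltO (k' := x)) //; last exact: ltn_trans kx.
    by case/orP.
  by rewrite (op_nc op Bs B0s xB vB0 kB pB0 xv vk kp).
left; split=> // V' V's k kV'; apply/negP => kB.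
have E : V = V'.
  apply: (op_sep op Bs _ _ vV (subsetP VB _ vV) kV' kB); first exact: mem_head.
  by rewrite inE V's orbT.
by have := ltV _ V's v v vV; rewrite -E => /(_ vV); rewrite (oo_irr ltO).
Qed.

Lemma op_join_only V s sigma B : 
  open_partition lt x.+1 (V :: s) sigma -> B \in sigma -> x \in B ->
  V \subset B -> (forall V', V' \in s -> forall k, k \in V' -> k \notin B) ->
  ~ (exists2 p : 'I_n, p \in B & (p < x)%N) -> B = x |: V.
Proof.
move=> op Bs xB VB sepB noB; apply/eqP; rewrite eqEsubset subUset sub1set xB VB !andbT.
apply/fintype.subsetP => k kB; rewrite !inE.
have [kx|[V' V's kV]] := (op_cover op k).1 (ex_intro2 _ _ B Bs kB).
  move: kx; rewrite ltnS leq_eqVlt => /predU1P[/val_inj->|kx]; first by rewrite eqxx.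
  by case: noB; exists k.
move: V's; rewrite inE => /predU1P[<-|V's]; first by rewrite kV orbT.
by move: (sepB _ V's _ kV); rewrite kB.
Qed.

(** The four cases for the block of [x] are exclusive and exhaust all the
    partitions. When no block is open only the two cases of a new block remain. *)
Lemma open_sum_left s : ordered_state lt x.+1 s ->
  open_sum lt x.+1 s = open_sum lt x ([set x] :: s) + W [set x] * open_sum lt x s +
    (if s is V :: s' then
       open_sum lt x ((x |: V) :: s') + W (x |: V) * open_sum lt x s' else 0).
Proof.
move=> oss.
have gt V : V \in s -> forall k : 'I_n, k \in V -> (x < k)%N.
  by move=> Vs k; exact: (os_ge oss Vs).
have old (P : {set {set 'I_n}} -> Prop) (Q : pred {set {set 'I_n}})
    (P' : {set {set 'I_n}} -> Prop) :
    (forall sigma, P' sigma <-> P sigma /\ Q sigma) ->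
    \sum_(sigma | `[< P sigma >] && Q sigma) \prod_(B in sigma) W B =
    \sum_(sigma | `[< P' sigma >]) \prod_(B in sigma) W B.
  move=> H; apply: eq_bigl => sigma; apply/andP/asboolP.
    by move=> [/asboolP ? ?]; apply/H.
  by move=> /H[? ?]; split=> //; apply/asboolP.
rewrite [LHS](bigID (fun sigma => [set x] \in sigma)) /=.
rewrite (sum_close (P1 := open_partition lt x s)); first last.
- by move=> sigma; exact: op_close_single.
- by move=> sigma; apply: op_notin; rewrite ?set11.
rewrite -/(open_sum lt x s) [RHS]addrAC [LHS]addrC; congr (_ + _).
have old1 sigma : open_partition lt x ([set x] :: s) sigma -> 
   [set x] \notin sigma.
  move=> /(op_open_new _ oss)[op [B Bs [xB [p pB px] _]]].
  apply/negP => /(op_triv op Bs)/(_ _ xB (set11 x)) E; move: pB px.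
  by rewrite E inE => /eqP->; rewrite ltnn.
case: s oss gt old1 => [|V s] oss gt old1.
  rewrite addr0; apply: old => sigma; split.
    move=> op; split; last exact: old1.
    by have [] := (op_open_new sigma oss).1 op.
  move=> [op xs]; apply/(op_open_new sigma oss); split=> //.
  have [B Bs xB] := op_block op; exists B => //.
  have [ex|/(op_single op Bs xB)E] := pselect (exists2 p : 'I_n, p \in B & (p < x)%N).
    by split.
  by move: xs; rewrite -E ?Bs.
rewrite (bigID (fun sigma => x |: V \in sigma)) /=.
have [v vV] := os_neq0 oss (mem_head _ _).
have xv : (x < v)%N by exact: gt (mem_head _ _) _ vV.
have xnV : [set x] <> x |: V.
  move/setP/(_ v); rewrite !inE vV orbT => /eqP E.
  by move: xv; rewrite E ltnn.
have xVn sigma : open_partition lt x.+1 (V :: s) sigma -> x |: V \in sigma -> [set x] \notin sigma.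
  move=> op xVs; apply/negP => xs.
  by apply: xnV; apply: (op_triv op xs xVs (k := x)); rewrite ?set11 ?setU11.
have -> : \sum_(sigma | `[< open_partition lt x.+1 (V :: s) sigma >] &&
     ([set x] \notin sigma) && (x |: V \in sigma)) \prod_(B in sigma) W B =
     W (x |: V) * open_sum lt x s.
  rewrite -(sum_close (P2 := open_partition lt x.+1 (V :: s))); first last.
  - by move=> sigma; exact: op_close_join.
  - move=> sigma; apply: op_notin; rewrite ?setU11 // => U Us.
    by apply: gt; rewrite inE Us orbT.
  apply: eq_bigl => sigma; rewrite -andbA; apply/and3P/andP.
    by move=> [].
  by move=> [op xVs]; split=> //; apply: (xVn sigma) => //; apply/asboolP.
rewrite [RHS]addrA [LHS]addrC; congr (_ + _).
rewrite [RHS]addrC (bigID (fun sigma => `[< open_partition lt x ((x |: V) :: s) sigma >])) /=.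
have oldV sigma : open_partition lt x ((x |: V) :: s) sigma ->
   (x |: V \notin sigma) /\ ([set x] \notin sigma).
  move=> /(op_open_join _ oss)[op [B Bs [xB [p pB px] VB]]]; split.
    apply/negP => xVs; have E := op_triv op xVs Bs (setU11 _ _) xB.
    move: pB; rewrite -E !inE => /predU1P[E'|]; first by rewrite E' ltnn in px.
    move=> /(gt _ (mem_head _ _)) /(ltn_trans px).
    by rewrite ltnn.
  apply/negP => xs; have E := op_triv op xs Bs (set11 x) xB.
  by move: pB; rewrite -E inE => /eqP E'; rewrite E' ltnn in px.
congr (_ + _).
  rewrite /open_sum; apply: eq_bigl => sigma; apply/andP/asboolP.
    by move=> [_ /asboolP].
  move=> op; have [nV nx] := oldV _ op; split; last exact/asboolP.
  rewrite nV nx !andbT; apply/asboolP.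
  by have [] := (op_open_join sigma oss).1 op.
rewrite /open_sum; apply: eq_bigl => sigma; apply/idP/asboolP.
  move=> /andP[/andP[/andP[/asboolP op xs] xVs] /asboolP nop].
  apply/(op_open_new sigma oss); split=> //.
  have [B Bs xB] := op_block op; exists B => //.
  have [[VB sepB]|sepB] := op_meets_head oss op Bs xB.
    have [ex|/(op_join_only op Bs xB VB sepB) E] :=
        pselect (exists2 p : 'I_n, p \in B & (p < x)%N).
      by case: nop; apply/(op_open_join sigma oss); split=> //; exists B.
    by move: xVs; rewrite -E Bs.
  have [ex|/(op_single op Bs xB sepB)E] := pselect (exists2 p : 'I_n, p \in B & (p < x)%N).
    by split.
  by move: xs; rewrite -E Bs.
move=> op'; have xs := old1 _ op'.
have [op [B Bs [xB _ sepB]]] := (op_open_new sigma oss).1 op'.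
rewrite xs andbT; apply/andP; split.
  apply/andP; split; first exact/asboolP.
  apply/negP => xVs; have E := op_triv op xVs Bs (setU11 _ _) xB.
  by move: (sepB V v (mem_head _ _) vV); rewrite -E !inE vV orbT.
apply/asboolP => /(op_open_join _ oss)[_ [B' B's [xB' _ VB']]].
have E := op_triv op B's Bs xB' xB.
by move: (sepB V v (mem_head _ _) vV); rewrite -E (subsetP VB' _ vV).
Qed.

End LeftStep.
End Weighted.
End OpenPartitions.

(** * Vacuum expectations on Fock space *)

Lemma pairwise_rev (A : Type) (r : rel A) (s : seq A) :
  pairwise r (rev s) = pairwise (fun a b => r b a) s.
Proof.
elim: s => //= x s IH; rewrite rev_cons pairwise_rcons all_rev IH.
by [].
Qed.

Section Reversal.
Context (n : nat).
Implicit Types (lt : rel 'I_n) (s : seq {set 'I_n}).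

(** Exchanging left and right reverses the order of the positions and the list of
    open blocks, so that right letters reduce to left ones. *)
Definition rev_rel lt : rel 'I_n := fun a b => lt b a.

Lemma outside_order_rev lt : outside_order lt -> outside_order (rev_rel lt).
Proof.
move=> H; split.
- exact: (oo_irr H).
- by move=> b a c /= ab bc; exact: (oo_trans H) bc ab.
- by move=> a b ab; rewrite orbC; exact: (oo_total H).
- have E (p k : 'I_n) : (p < k)%N -> lt k p = ~~ lt p k.
    move=> pk; apply/idP/negP => [kp pk'|/negP npk].
      by have := oo_trans H kp pk'; rewrite (oo_irr H).
    have := oo_total H (a := p) (b := k); rewrite (negPf npk) /=; apply.
    by apply/eqP => E; rewrite E ltnn in pk.
  by move=> p k k' pk pk'; rewrite /rev_rel (E _ _ pk) (E _ _ pk') (oo_out H pk pk').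
Qed.

Lemma ordered_state_rev lt m s :
  ordered_state lt m s -> ordered_state (rev_rel lt) m (rev s).
Proof.
move=> H; split.
- by move=> V; rewrite mem_rev; exact: (os_neq0 H).
- by move=> V; rewrite mem_rev; exact: (os_ge H).
- rewrite pairwise_rev; apply: sub_pairwise (os_pairwise H) => V U /forall_inP UV.
  apply/forall_inP => a aU; apply/forall_inP => b bV.
  by have /forall_inP := UV _ bV; apply.
Qed.

Lemma open_partition_rev lt m s sigma :
  open_partition lt m s sigma -> open_partition (rev_rel lt) m (rev s) sigma.
Proof.
move=> H; split.
- move=> k; rewrite (op_cover H); split; (case; first by left).
    by move=> [V Vs kV]; right; exists V; rewrite ?mem_rev.
  by move=> [V + kV]; rewrite mem_rev => Vs; right; exists V.
- exact: (op_triv H).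
- exact: (op_neq0 H).
- move=> V U Vs Us a b c d aV bU cV dU ab bc cd.
  by rewrite (op_nc H Us Vs dU cV bU aV cd bc ab).
- by move=> V; rewrite mem_rev; exact: (op_ext H).
- by move=> B V V' Bs; rewrite !mem_rev; exact: (op_sep H).
Qed.

Lemma open_sum_rev (C : numClosedFieldType) (W : {set 'I_n} -> C) lt m s :
  open_sum W (rev_rel lt) m (rev s) = open_sum W lt m s.
Proof.
apply: eq_bigl => sigma; apply/asboolP/asboolP; last exact: open_partition_rev.
by move=> /open_partition_rev; rewrite revK.
Qed.

End Reversal.

Section Fock.
Context (C : numClosedFieldType) (T : choiceType) (isl : T -> bool).
Context (K : seq T -> C).


(** A vector of the Fock space is a formal combination of lists of words, each list
    standing for an elementary tensor. [step_left x] is the sum of the creation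
    operator, of multiplication by K [:: x], of the preservation operator and of
    the annihilation operator attached to a left letter. *)
Definition step_left (x : T) (s : seq (seq T)) : seq (C * seq (seq T)) :=
  [:: (1, [:: x] :: s), (K [:: x], s) &
   if s is V :: s' then [:: (1, (x :: V) :: s'); (K (x :: V), s')] else [::]].

Definition step (x : T) (s : seq (seq T)) : seq (C * seq (seq T)) :=
  if isl x then step_left x s
  else [seq (p.1, rev p.2) | p <- step_left x (rev s)].

(** [vac w s] is the coefficient of the vacuum in the vector obtained from the
    tensor [s] by applying the operators of the letters of [w], the first letter
    of [w] first. Moments of a word therefore use its reversal. *)
Fixpoint vac (w : seq T) (s : seq (seq T)) : C :=
  if w is x :: u then \sum_(p <- step x s) p.1 * vac u p.2 else (s == [::])%:R.

Section Positions.
Context (n : nat) (f : 'I_n -> T).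

Definition subword (V : {set 'I_n}) : seq T := [seq f k | k <- enum V].

(** The order that underlies bi-non-crossing partitions: the left positions upwards,
    then the right positions downwards. *)
Definition bilt : rel 'I_n := fun a b =>
  if isl (f a) then ~~ isl (f b) || (a < b)%N else ~~ isl (f b) && (b < a)%N.

Lemma bilt_outside : outside_order bilt.
Proof.
rewrite /bilt; split.
- by move=> a; case: (isl _); rewrite /= ltnn.
- move=> b a c; case: (isl (f a)) (isl (f b)) (isl (f c)) => [] [] [] //=.
    exact: ltn_trans.
  by move=> ba cb; exact: ltn_trans ba.
- move=> a b ab; case: (isl (f a)) (isl (f b)) => [] [] //=;
    by rewrite ?(orbC (b < a)%N) -neq_ltn.
- move=> p k k' pk pk'; case: (isl (f p)) => /=; first by rewrite pk pk' !orbT.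
  by rewrite !ltnNge (ltnW pk) (ltnW pk') !andbF.
Qed.

Lemma subword1 (x : 'I_n) : subword [set x] = [:: f x].
Proof. by rewrite /subword enum_set1. Qed.

Lemma enum_sorted (A : {pred 'I_n}) : sorted (fun i j : 'I_n => (i < j)%N) (enum A).
Proof.
rewrite /enum_mem -enumT; apply: sorted_filter; first by move=> a b c; exact: ltn_trans.
have : sorted ltn (map val (enum 'I_n)) by rewrite val_enum_ord iota_ltn_sorted.
by rewrite sorted_map.
Qed.

Lemma subwordU1 (x : 'I_n) (V : {set 'I_n}) : (forall k : 'I_n, k \in V -> (x < k)%N) ->
  subword (x |: V) = f x :: subword V.
Proof.
move=> xV; rewrite /subword -map_cons; congr map.
apply: (@irr_sorted_eq _ (fun i j : 'I_n => (i < j)%N)).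
- by move=> a b c; exact: ltn_trans.
- by move=> a; exact: ltnn.
- exact: enum_sorted.
- have := enum_sorted V; case E : (enum V) => [//|k t] /= ->; rewrite andbT.
  by apply: xV; rewrite -mem_enum E mem_head.
- by move=> k; rewrite inE !mem_enum !inE.
Qed.

Let wt (V : {set 'I_n}) := K (subword V).
Let w := [seq f k | k <- enum 'I_n].

(** Once everything is read, an open block could no longer be continued. *)
Lemma open_sum0 (lt : rel 'I_n) s : open_sum wt lt 0 s = (s == [::])%:R.
Proof.
have op0 : open_partition lt 0 [::] set0.
  split=> [k|B B'|B|V B|V|B V V']; rewrite ?inE//.
  by split; [case=> V; rewrite inE|case=> // -[]].
have E sigma : open_partition lt 0 s sigma <-> (s == [::]) && (sigma == set0).
  split=> [op|/andP[/eqP-> /eqP->]//].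
  have s0 : s = [::].
    case: s op => // V s op.
    by have [B _ [_ [p]]] := op_ext op (mem_head _ _).
  rewrite s0 eqxx; apply/eqP/setP => B; rewrite inE; apply/negP => Bs.
  have [k kB] := op_neq0 op Bs.
  have [//|] := (op_cover op k).1 (ex_intro2 _ _ B Bs kB).
  by rewrite s0 => -[].
rewrite [LHS](eq_bigl (fun sigma : {set {set 'I_n}} => (s == [::]) && (sigma == set0))); last first.
  by move=> sigma; apply/asboolP/idP => /E.
case: eqP => _ /=; first by rewrite big_pred1_eq big_set0.
by rewrite big_pred0.
Qed.

Lemma ordered_stateW (lt : rel 'I_n) (m : nat) s :
  ordered_state lt m.+1 s -> ordered_state lt m s.
Proof.
move=> H; split; [exact: (os_neq0 H)| |exact: (os_pairwise H)].
by move=> V Vs k kV; apply/ltnW/(os_ge H Vs).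
Qed.

Lemma ordered_state_cons (lt : rel 'I_n) (x : 'I_n) (V : {set 'I_n}) s :
  (forall k : 'I_n, (x < k)%N -> lt x k) ->
  ordered_state lt x.+1 (V :: s) ->
  ordered_state lt x ((x |: V) :: s) /\ ordered_state lt x.+1 s.
Proof.
move=> xlt H; have sV U : U \in s -> U \in V :: s by rewrite inE orbC => ->.
have := os_pairwise H; rewrite /= => /andP[/os_pairwiseP Vs ps].
split; split=> //.
- move=> U; rewrite inE => /predU1P[->|/sV]; last exact: (os_neq0 H).
  by exists x; rewrite setU11.
- move=> U; rewrite inE => /predU1P[-> k|/sV Us k kU]; last first.
    by apply/ltnW/(os_ge H Us).
  by rewrite !inE => /predU1P[->//|kV]; apply/ltnW/(os_ge H (mem_head _ _)).
- rewrite /= ps andbT; apply/os_pairwiseP => U Us a b.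
  rewrite !inE => /predU1P[->|aV] bU; last exact: (Vs U).
  by apply/xlt/(os_ge H (sV _ Us)).
- by move=> U /sV; exact: (os_neq0 H).
- by move=> U /sV; exact: (os_ge H).
Qed.

Lemma ordered_state_new (lt : rel 'I_n) (x : 'I_n) s :
  (forall k : 'I_n, (x < k)%N -> lt x k) ->
  ordered_state lt x.+1 s -> ordered_state lt x ([set x] :: s).
Proof.
move=> xlt H; split.
- move=> U; rewrite inE => /predU1P[->|]; last exact: (os_neq0 H).
  by exists x; rewrite set11.
- move=> U; rewrite inE => /predU1P[-> k|Us k kU]; last first.
    by apply/ltnW/(os_ge H Us).
  by rewrite inE => /eqP->.
- rewrite /= (os_pairwise H) andbT; apply/os_pairwiseP => U Us a b.
  by rewrite inE => /eqP-> bU; apply/xlt/(os_ge H Us).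
Qed.

Lemma open_sum_step_left (lt : rel 'I_n) (x : 'I_n) (s : seq {set 'I_n}) (g : seq (seq T) -> C) :
  outside_order lt -> (forall k : 'I_n, (x < k)%N -> lt x k) ->
  ordered_state lt x.+1 s ->
  (forall s', ordered_state lt x s' -> open_sum wt lt x s' = g (map subword s')) ->
  open_sum wt lt x.+1 s =
  \sum_(p <- step_left (f x) (map subword s)) p.1 * g p.2.
Proof.
move=> ltO xlt oss IH.
rewrite open_sum_left // !big_cons /= mul1r addrA.
rewrite (IH s (ordered_stateW oss)) (IH _ (ordered_state_new xlt oss)).
rewrite map_cons subword1 /wt subword1; congr (_ + _).
case: s oss => [|V s] oss; first by rewrite big_nil.
have [oss1 oss2] := ordered_state_cons xlt oss.
rewrite /= !big_cons big_nil addr0 /= mul1r (IH _ oss1) (IH _ (ordered_stateW oss2)).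
have xV k : k \in V -> (x < k)%N by exact: (os_ge oss (mem_head _ _)).
by rewrite map_cons subwordU1.
Qed.

(** The sum over the partitions of the word obeys the recursion that defines
    [vac], because the bookkeeping of open blocks is that of [step]. *)
Lemma open_sum_vac m s : (m <= n)%N -> ordered_state bilt m s ->
  open_sum wt bilt m s = vac (rev (take m w)) (map subword s).
Proof.
elim: m s => [|m IH] s mn oss.
  by rewrite open_sum0 take0 /=; case: s {oss}.
pose x := Ordinal mn.
have sw : (m < size w)%N by rewrite size_map size_enum_ord.
rewrite (take_nth (f x) sw) rev_rcons (_ : nth _ _ _ = f x); last first.
  by rewrite (nth_map x) ?size_enum_ord//; congr f; apply: val_inj; rewrite /= nth_enum_ord.
rewrite /= /step; have [lx|rx] := boolP (isl (f x)).
  rewrite (open_sum_step_left (x := x) (g := vac (rev (take m w))) bilt_outside) //.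
    by move=> k xk; rewrite /bilt lx xk orbT.
  by move=> s'; apply: IH; exact: ltnW.
rewrite big_map -open_sum_rev.
rewrite (open_sum_step_left (x := x) (g := fun s => vac (rev (take m w)) (rev s))).
- by rewrite map_rev.
- exact/outside_order_rev/bilt_outside.
- by move=> k xk; rewrite /rev_rel /bilt rx /= xk; case: (isl (f k)).
- exact: ordered_state_rev.
- move=> s' /ordered_state_rev; rewrite (_ : rev_rel _ = bilt) // => oss'.
  by rewrite -map_rev -IH ?(ltnW mn)// -[in LHS](revK s') open_sum_rev.
Qed.

End Positions.
End Fock.

(** * Bi-non-crossing partitions *)

Section BiNoncrossingOrder.
Context (I J : Type) (T : choiceType) (c : T -> I + J).

Definition left_letter (x : T) : bool := if c x is inl _ then true else false.

Context (n : nat) (f : 'I_n -> T).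

Let chi := c \o f.
Let lt := bilt left_letter f.

Lemma chi_order_pairwise : pairwise lt (chi_order chi).
Proof.
have enum_pw : pairwise (fun i j : 'I_n => (i < j)%N) (enum 'I_n).
  rewrite -sorted_pairwise; last by move=> a b d; exact: ltn_trans.
  exact: enum_sorted.
have lE a b : lt a b = if Defs.is_left chi a then ~~ Defs.is_left chi b || (a < b)%N
                       else ~~ Defs.is_left chi b && (b < a)%N by [].
rewrite /chi_order pairwise_cat pairwise_rev; apply/and3P; split.
- apply/allrelP => a b; rewrite mem_rev !mem_filter => /andP[la _] /andP[lb _].
  by rewrite lE la lb.
- apply: (@sub_in_pairwise _ (mem (Defs.is_left chi)) (fun i j : 'I_n => (i < j)%N)).
  + by move=> a b la lb ab; rewrite lE; move: la lb; rewrite !unfold_in => -> ->.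
  + by apply/allP => k; rewrite mem_filter => /andP[].
  + exact: pairwise_filter.
- apply: (@sub_in_pairwise _ [predC Defs.is_left chi] (fun i j : 'I_n => (i < j)%N)).
  + by move=> a b /negPf la /negPf lb ab; rewrite lE [Defs.is_left chi a]la [Defs.is_left chi b]lb.
  + by apply/allP => k; rewrite mem_filter => /andP[].
  + exact: pairwise_filter.
Qed.

Lemma s_chi_lt (a b : 'I_n) : lt (s_chi chi a) (s_chi chi b) = (a < b)%N.
Proof.
have mono (i j : 'I_n) : (i < j)%N -> lt (s_chi chi i) (s_chi chi j).
  move=> ij; rewrite /s_chi.
  have sz : size (chi_order chi) = n.
    by rewrite size_cat size_rev !size_filter count_predC size_enum_ord.
  rewrite [X in lt _ X](set_nth_default i) ?sz //.
  by have /(pairwiseP i) := chi_order_pairwise; apply; rewrite ?inE ?sz.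
have ltO : outside_order lt by exact: bilt_outside.
have [/mono//|ba|/val_inj->] := ltngtP a b; last by rewrite (oo_irr ltO).
apply/negP => ab; have := oo_trans ltO ab (mono _ _ ba).
by rewrite (oo_irr ltO).
Qed.

(** Transporting by [s_chi], which is increasing from the usual order to [bilt],
    turns non-crossing partitions into partitions that do not cross for [bilt]. *)
Lemma mem_BNC (sigma : {set {set 'I_n}}) :
  sigma \in BNC chi <-> partition sigma [set: 'I_n] /\ noncrossing_for lt sigma.
Proof.
have sI : injective (s_chi chi) := @s_chi_inj _ _ _ chi.
split=> [sB|[piP pinc]].
  split; first exact: BNC_partition sB.
  move: sB => /imsetP[pi]; rewrite inE => /andP[_ /forall_inP nc] ->.
  move=> V W /imsetP[V0 V0pi ->] /imsetP[W0 W0pi ->] a b d e.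
  move=> /imsetP[a0 aV ->] /imsetP[b0 bW ->] /imsetP[d0 dV ->] /imsetP[e0 eW ->].
  rewrite !s_chi_lt => ab bd de; congr (_ @: _); apply/eqP.
  have /forall_inP/(_ _ W0pi)/forall_inP/(_ _ aV)/forall_inP/(_ _ bW) := nc _ V0pi.
  move=> /forall_inP/(_ _ dV)/forall_inP/(_ _ eW). by rewrite ab bd de => /implyP/(_ isT)/eqP->.
have [g gK Kg] := injF_bij sI.
have imK (V : {set 'I_n}) : [set s_chi chi x | x in [set g y | y in V]] = V.
  by rewrite -imset_comp -[RHS]imset_id; apply: eq_imset => y /=; rewrite Kg.
apply/imsetP; exists [set [set g y | y in V : {set 'I_n}] | V : {set 'I_n} in sigma]; last first.
  by rewrite -imset_comp -[LHS]imset_id; apply: eq_imset => V /=; rewrite imK.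
have gI : injective g by exact: can_inj Kg.
rewrite inE; apply/andP; split.
  rewrite -(_ : [set g y | y in [set: 'I_n]] = [set: 'I_n]).
    by rewrite (imset_partition _ _ gI).
  by apply/eqP; rewrite eqEcard finset.subsetT card_imset ?leqnn.
have gP (V : {set 'I_n}) a : a \in [set g y | y in V] -> s_chi chi a \in V.
  by move=> /imsetP[y yV ->]; rewrite Kg.
apply/forall_inP => _ /imsetP[V Vs ->]; apply/forall_inP => _ /imsetP[U Us ->].
apply/forall_inP => a /gP aV; apply/forall_inP => b /gP bU.
apply/forall_inP => d /gP dV; apply/forall_inP => e /gP eU.
apply/implyP => /and3P[ab bd de].
by rewrite (pinc _ _ Vs Us _ _ _ _ aV bU dV eU) ?s_chi_lt.
Qed.

Context (C : numClosedFieldType) (K : seq T -> C).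

(** The bi-free moment-cumulant formula with [K] in place of the cumulants. *)
Definition moment_of : C :=
  \sum_(pi in BNC chi) \prod_(V in pi) K (subword f V).

Lemma moment_of_vac :
  moment_of = vac left_letter K (rev [seq f k | k <- enum 'I_n]) [::].
Proof.
have sz : size [seq f k | k <- enum 'I_n] = n by rewrite size_map size_enum_ord.
have := @open_sum_vac _ _ left_letter K _ f n [::] (leqnn n).
rewrite take_oversize ?sz // => <-; last by split.
rewrite /open_sum /moment_of; apply: eq_bigl => sigma.
apply/idP/asboolP => [/mem_BNC[piP nc]|op].
  have /and3P[/eqP cov tI n0] := piP.
  split=> //.
  - move=> k; split=> [_|_]; first by left; exact: ltn_ord.
    have : k \in cover sigma by rewrite cov inE.
    by case/bigcupP => B; exists B.
  - move=> B B' Bs B's k kB kB'.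
    by rewrite -(def_pblock tI Bs kB) (def_pblock tI B's kB').
  - move=> B Bs; have /set0Pn := partition_neq0 piP Bs.
    by [].
apply/mem_BNC; split; last exact: (op_nc op).
apply/and3P; split.
- apply/eqP/setP => k; rewrite inE; apply/bigcupP.
  have [B Bs kB] := (op_cover op k).2 (or_introl (ltn_ord k)).
  by exists B.
- apply/trivIsetP => A B As Bs; apply: contraR.
  rewrite -setI_eq0 => /set0Pn[k]; rewrite inE => /andP[kA kB].
  by rewrite (op_triv op As Bs kA kB).
- by apply/negP => /(op_neq0 op)[k]; rewrite inE.
Qed.

End BiNoncrossingOrder.

(** * Positive kernels and the Schur product theorem *)

Section PositiveKernels.
Context (C : numClosedFieldType).

Section Kernels.
Context (X : Type).
Implicit Types (D : pred X) (k : X -> X -> C) (v : seq (C * X)).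

Definition kform k v : C :=
  \sum_(p <- v) \sum_(q <- v) p.1^* * q.1 * k p.2 q.2.

Definition psd_on D k : Prop :=
  forall v, all (fun p => D p.2) v -> 0 <= kform k v.

(** Polarization: evaluate the form on x + a y for a = 1 and a = i. *)
Lemma psd_on_hermitian D k x y : psd_on D k -> D x -> D y -> k x y = (k y x)^*.
Proof.
move=> kP Dx Dy.
have real1 z : D z -> k z z \is Num.real.
  move=> Dz; have := kP [:: (1, z)]; rewrite /= Dz /kform !big_seq1 /=.
  by rewrite conjC1 !mul1r => /(_ isT) /ger0_real.
have real2 (a : C) : (a * k x y + a^* * k y x) \is Num.real.
  have := kP [:: (1, x); (a, y)]; rewrite /= Dx Dy => /(_ isT) /ger0_real.
  rewrite /kform !big_cons !big_nil /= !addr0 conjC1 !mul1r mulr1.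
  have r3 : a^* * a * k y y \is Num.real.
    by rewrite realM ?real1// mulrC -normCK realX ?normr_real.
  have -> : k x x + a * k x y + (a^* * k y x + a^* * a * k y y) =
            (a * k x y + a^* * k y x) + (k x x + a^* * a * k y y) by ring.
  move=> /realB /(_ (realD (real1 _ Dx) r3)).
  by rewrite addrK.
have /CrealP E1 := real2 1; have /CrealP E2 := real2 'i.
rewrite conjC1 !mul1r rmorphD /= in E1.
rewrite rmorphD !rmorphM /= conjCK conjCi in E2.
have i0 : 'i != 0 :> C by exact: neq0Ci.
have {}E2 : (k y x)^* - (k x y)^* = k x y - k y x.
  apply: (mulfI i0); rewrite !mulrBr.
  by move: E2; rewrite !mulNr addrC.
apply: (mulfI (_ : 2 != 0 :> C)); first by rewrite pnatr_eq0.
have -> : 2 * k x y = (k x y + k y x) + (k x y - k y x) by ring.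
by rewrite -E1 -E2; ring.
Qed.

Lemma psd_on_comap (Y : Type) D (D' : pred Y) k (h : Y -> X) :
  (forall y, D' y -> D (h y)) -> psd_on D k ->
  forall v : seq (C * Y), all (fun p => D' p.2) v ->
    0 <= \sum_(p <- v) \sum_(q <- v) p.1^* * q.1 * k (h p.2) (h q.2).
Proof.
move=> DD' kP v vD.
have := kP [seq (p.1, h p.2) | p <- v]; rewrite /kform big_map all_map.
under eq_bigr do rewrite big_map /=.
by apply; apply: sub_all vD => p; exact: DD'.
Qed.

(** The spectral theorem for the Gram matrix; its eigenvalues are values of the
    form, hence nonnegative. *)
Lemma psd_on_decomposition D k n (x : 'I_n -> X) :
  psd_on D k -> (forall i, D (x i)) ->
  exists (P : 'I_n -> 'I_n -> C) (d : 'I_n -> C),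
    (forall a, 0 <= d a) /\
    forall i j, k (x i) (x j) = \sum_a (P a i)^* * d a * P a j.
Proof.
move=> kP Dx; pose A := \matrix_(i, j) k (x i) (x j).
have Aherm : A \is hermsymmx.
  apply/is_hermitianmxP; rewrite expr0 scale1r; apply/matrixP => i j.
  by rewrite !mxE (psd_on_hermitian kP).
have /orthomx_spectralP AE := hermitian_normalmx Aherm.
have PU := spectral_unitarymx A; rewrite invmx_unitary // in AE.
set P := spectralmx A in AE PU; set d := spectral_diag A in AE.
exists (fun a i => P a i), (fun a => d 0 a); split=> [a|i j].
  have DE : diag_mx d = P *m A *m map_mx Num.conj P^T.
    rewrite AE !mulmxA (unitarymxP PU) mul1mx -mulmxA.
    by rewrite (unitarymxP PU) mulmx1.
  have -> : d 0 a = diag_mx d a a by rewrite mxE eqxx mulr1n.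
  rewrite DE mxE; under eq_bigr do rewrite mxE big_distrl /=.
  rewrite exchange_big /=.
  have := kP [seq ((P a i)^*, x i) | i <- enum 'I_n].
  rewrite /kform big_map big_enum all_map /=.
  under eq_bigr do rewrite big_map big_enum /=.
  move=> H; have {}H := H ltac:(by apply/allP => i _; exact: Dx).
  rewrite (_ : \sum_j _ = \big[+%R/0]_(i < n) \sum_(j < n)
    ((P a i)^*)^* * (P a j)^* * k (x i) (x j)) //.
  apply: eq_bigr => j _; apply: eq_bigr => i _.
  by rewrite !mxE conjCK mulrAC.
have -> : k (x i) (x j) = A i j by rewrite mxE.
rewrite {1}AE mxE; apply: eq_bigr => a _.
by rewrite mul_mx_diag !mxE.
Qed.


Lemma kform_tnth k v :
  kform k v = \sum_(i < size v) \sum_(j < size v)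
    (tnth (in_tuple v) i).1^* * (tnth (in_tuple v) j).1 *
    k (tnth (in_tuple v) i).2 (tnth (in_tuple v) j).2.
Proof. by rewrite /kform big_tnth; under eq_bigr do rewrite big_tnth. Qed.

(** Decomposing one Gram matrix into rank-one pieces turns the form of the product
    kernel into a nonnegative combination of values of the other form. *)
Lemma psd_on_mul D k1 k2 : psd_on D k1 -> psd_on D k2 ->
  psd_on D (fun x y => k1 x y * k2 x y).
Proof.
move=> k1P k2P v vD; rewrite kform_tnth.
set c := fun i => (tnth (in_tuple v) i).1; set x := fun i => (tnth (in_tuple v) i).2.
have Dx i : D (x i) by have /(all_tnthP (t := in_tuple v)) := vD; apply.
have [P [d [d0 k1E]]] := psd_on_decomposition k1P Dx.
rewrite (_ : \sum_i _ = \sum_a d a *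
    kform k2 [seq (P a i * c i, x i) | i <- enum 'I_(size v)]).
  apply: sumr_ge0 => a _; apply: mulr_ge0 => //; apply: k2P.
  by rewrite all_map; apply/allP => i _; exact: Dx.
rewrite /kform; under [RHS]eq_bigr => a _.
  rewrite big_map big_enum /=.
  under eq_bigr do rewrite big_map big_enum /=.
  rewrite big_distrr /=; under eq_bigr do rewrite big_distrr /=.
  over.
rewrite [RHS]exchange_big /=; apply: eq_bigr => i _.
rewrite [RHS]exchange_big /=; apply: eq_bigr => j _.
rewrite -/(c i) -/(c j) -/(x i) -/(x j) k1E big_distrl big_distrr /=.
by apply: eq_bigr => a _; rewrite rmorphM /=; ring.
Qed.

End Kernels.
End PositiveKernels.

(** * Positivity of the Fock functional *)

Section FockPositivity.
Context (C : numClosedFieldType) (T : choiceType) (isl : T -> bool).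
Context (K : seq T -> C).

Let nonempty : pred (seq T) := fun u => u != [::].
Let good : pred (seq (seq T)) := all nonempty.

(** Reversal is the involution on words, so this is (u, v) |-> K(u^* v). *)
Definition block_kernel (u v : seq T) : C := K (rev u ++ v).

Hypothesis K_psd : psd_on nonempty block_kernel.
Hypothesis K_real1 : forall x, (K [:: x])^* = K [:: x].

(** The inner product of two elementary tensors; tensors of different degrees are
    orthogonal. *)
Definition fock_kernel (s t : seq (seq T)) : C :=
  if size s == size t then \prod_(p <- zip s t) block_kernel p.1 p.2 else 0.

Lemma fock_kernel_cons u v s t :
  fock_kernel (u :: s) (v :: t) = block_kernel u v * fock_kernel s t.
Proof.
rewrite /fock_kernel /= eqSS; case: ifP => _; first by rewrite big_cons.
by rewrite mulr0.
Qed.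

Lemma fock_kernel0 s : fock_kernel [::] s = (s == [::])%:R.
Proof. by case: s => [|v s]; rewrite /fock_kernel //= big_nil. Qed.

Lemma fock_kernel_cons0 u s : fock_kernel (u :: s) [::] = 0.
Proof. by []. Qed.

Lemma fock_kernel_rev s t : fock_kernel (rev s) (rev t) = fock_kernel s t.
Proof.
rewrite /fock_kernel !size_rev; case: eqP => // st.
by rewrite -rev_zip // (perm_big (zip s t)) // perm_rev.
Qed.

(** On tensors of degree at least 1 the kernel is the product of the kernel of the
    heads and that of the tails, so induction on the degree and Schur's theorem
    apply; degree 0 is orthogonal to the rest. *)
Lemma fock_kernel_psd : psd_on good fock_kernel.
Proof.
suff H N : psd_on (fun s => good s && (size s <= N)%N) fock_kernel.
  move=> v vD; apply: (H (\max_(p <- v) size p.2)%N); apply/allP => p pv.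
  by rewrite (allP vD _ pv) /=; apply: (leq_bigmax_seq (F := fun p => size p.2)).
elim: N => [|N IH] v vD.
  have E p : p \in v -> p.2 = [::].
    by move=> /(allP vD) /andP[_]; rewrite leqn0 size_eq0 => /eqP.
  rewrite (_ : kform _ _ = (\sum_(p <- v) p.1)^* * \sum_(p <- v) p.1).
    by rewrite mulrC -normCK exprn_ge0.
  rewrite /kform rmorph_sum big_distrl /= big_seq_cond [RHS]big_seq_cond.
  apply: eq_bigr => p /andP[pv _]; rewrite big_distrr /= big_seq_cond [RHS]big_seq_cond.
  by apply: eq_bigr => q /andP[qv _]; rewrite (E _ pv) (E _ qv) fock_kernel0 mulr1.
pose nilp2 (p : C * seq (seq T)) := p.2 == [::].
pose v0 := [seq p <- v | nilp2 p]; pose v1 := [seq p <- v | ~~ nilp2 p].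
have -> : kform fock_kernel v = kform fock_kernel v0 + kform fock_kernel v1.
  rewrite /kform (bigID nilp2) /= !big_filter; congr (_ + _).
    apply: eq_bigr => p /eqP p0; rewrite big_filter [LHS](bigID nilp2) /=.
    rewrite [X in _ + X]big1 ?addr0// => q q0.
    by rewrite p0 fock_kernel0; move: q0; rewrite /nilp2 => /negPf->; rewrite mulr0.
  apply: eq_bigr => p p0; rewrite big_filter [LHS](bigID nilp2) /=.
  rewrite [X in X + _]big1 ?add0r// => q /eqP q0.
  by rewrite q0; move: p0; rewrite /nilp2; case: (p.2) => // u s _; rewrite mulr0.
apply: addr_ge0.
  apply: IH; apply/allP => p; rewrite mem_filter => /andP[/eqP -> _].
  by [].
pose D s := [&& s != [::], good s & (size s <= N.+1)%N].
have headP : psd_on D (fun s t => block_kernel (head [::] s) (head [::] t)).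
  apply: psd_on_comap K_psd => -[|u s] //= /and3P[_ /andP[u0 _] _].
  exact: u0.
have tailP : psd_on D (fun s t => fock_kernel (behead s) (behead t)).
  apply: psd_on_comap IH => -[|u s] //= /and3P[_ /andP[_ gs] ss].
  exact/andP.
have v1D : all (fun p => D p.2) v1.
  apply/allP => p; rewrite mem_filter => /andP[p0 pv].
  by rewrite /D p0 (allP vD _ pv).
have := psd_on_mul headP tailP v1D; congr (0 <= _).
rewrite /kform big_seq_cond [RHS]big_seq_cond; apply: eq_bigr => p.
rewrite mem_filter andbT => /andP[+ _]; rewrite /nilp2.
case: p => a [|u s] //= _; rewrite big_seq_cond [RHS]big_seq_cond; apply: eq_bigr => q.
rewrite mem_filter andbT => /andP[+ _]; rewrite /nilp2.
by case: q => b [|u' s'] //= _; rewrite fock_kernel_cons.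
Qed.

Lemma block_kernel_conj u v : u != [::] -> v != [::] ->
  (block_kernel u v)^* = block_kernel v u.
Proof. by move=> u0 v0; rewrite -(psd_on_hermitian K_psd). Qed.

(** Creation is adjoint to annihilation, because K(u^* x) is the conjugate of
    K(x u), and the preservation operator is symmetric because
    K((x u)^* v) = K(u^* (x v)). Positivity on non-empty words is enough, since
    no operator meets an empty one. *)
Lemma step_left_sym x s t : good s -> good t ->
  \sum_(p <- step_left K x s) p.1^* * fock_kernel p.2 t =
  \sum_(q <- step_left K x t) q.1 * fock_kernel s q.2.
Proof.
have cons1 (u v : seq T) : block_kernel (x :: u) v = block_kernel u (x :: v).
  by rewrite /block_kernel rev_cons cat_rcons.
have conj_cons u : u != [::] -> (K (x :: u))^* = block_kernel u [:: x].
  by move=> u0; rewrite -(block_kernel_conj (u := [:: x]) (v := u)).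
rewrite /step_left; case: s t => [|u s] [|v t] gs gt;
  rewrite !big_cons /= !big_nil ?fock_kernel_cons ?fock_kernel_cons0 ?fock_kernel0 /=
    ?conjC1 ?K_real1 ?(mulr0, mulr1, mul1r, addr0, add0r) //.
  by move: gs => /andP[u0 _]; rewrite conj_cons.
move: gs => /andP[u0 _]; rewrite conj_cons // (cons1 u v) //.
by rewrite [block_kernel [:: x] v]/block_kernel /=; ring.
Qed.

Lemma step_good x s : good s -> all (fun p => good p.2) (step isl K x s).
Proof.
have left_good s' : good s' -> all (fun p => good p.2) (step_left K x s').
  rewrite /step_left; case: s' => [|u s'] //= /andP[u0 gs].
  by rewrite -/(good s') gs !andbT u0.
rewrite /step => gs; case: ifP => _; first exact: left_good.
rewrite all_map; have := left_good (rev s); rewrite /good all_rev => /(_ gs).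
by apply: sub_all => p /=; rewrite all_rev.
Qed.

Lemma step_sym x s t : good s -> good t ->
  \sum_(p <- step isl K x s) p.1^* * fock_kernel p.2 t =
  \sum_(q <- step isl K x t) q.1 * fock_kernel s q.2.
Proof.
move=> gs gt; rewrite /step; case: ifP => _; first exact: step_left_sym.
rewrite !big_map /=.
have := @step_left_sym x (rev s) (rev t); rewrite /good !all_rev => /(_ gs gt).
under eq_bigr do rewrite -fock_kernel_rev revK.
by under [in RHS]eq_bigr do rewrite -fock_kernel_rev revK.
Qed.

(** The vector created from the vacuum by the word [w], whose last letter acts
    first. *)
Fixpoint fock_vector (w : seq T) : seq (C * seq (seq T)) :=
  if w is x :: u then
    flatten [seq [seq (p.1 * q.1, q.2) | q <- step isl K x p.2] | p <- fock_vector u]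
  else [:: (1, [::])].

Lemma fock_vector_cons x u (F : C * seq (seq T) -> C) :
  \sum_(r <- fock_vector (x :: u)) F r =
  \sum_(p <- fock_vector u) \sum_(q <- step isl K x p.2) F (p.1 * q.1, q.2).
Proof.
by rewrite /= big_flatten big_map; apply: eq_bigr => p _; rewrite big_map.
Qed.

Lemma fock_vector_good w : all (fun p => good p.2) (fock_vector w).
Proof.
elim: w => //= x u IH; apply/allP => r /flattenP[l /mapP[p pu ->]].
move=> /mapP[q qs ->] /=.
by have /allP/(_ _ qs) := step_good x (allP IH _ pu).
Qed.

Lemma vac_fock_vector w s : good s ->
  vac isl K w s = \sum_(p <- fock_vector w) p.1^* * fock_kernel p.2 s.
Proof.
elim: w s => [|x u IH] s gs.
  by rewrite big_seq1 conjC1 mul1r fock_kernel0.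
rewrite fock_vector_cons [LHS]/=.
transitivity (\sum_(q <- step isl K x s) \sum_(p <- fock_vector u)
    q.1 * (p.1^* * fock_kernel p.2 q.2)).
  rewrite big_seq_cond [RHS]big_seq_cond; apply: eq_bigr => q /andP[qs _].
  by rewrite IH ?big_distrr//; exact: (allP (step_good x gs)).
rewrite exchange_big /= big_seq_cond [RHS]big_seq_cond.
apply: eq_bigr => p /andP[pu _].
transitivity (p.1^* * \sum_(q <- step isl K x s) q.1 * fock_kernel p.2 q.2).
  by rewrite big_distrr; apply: eq_bigr => q _; rewrite mulrCA.
rewrite -step_sym //; last exact: (allP (fock_vector_good u)).
rewrite big_distrr; apply: eq_bigr => q _.
by rewrite /= rmorphM mulrA.
Qed.

Lemma vac_cat w w' :
  vac isl K (rev w' ++ w) [::] = \sum_(p <- fock_vector w') p.1 * vac isl K w p.2.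
Proof.
elim: w' w => [|x w' IH] w; first by rewrite big_seq1 mul1r.
rewrite rev_cons cat_rcons IH fock_vector_cons; apply: eq_bigr => p _ /=.
by rewrite big_distrr; apply: eq_bigr => q _; rewrite /= mulrA.
Qed.

(** By symmetry of the operators, the moment of u^* v is the inner product of the
    vectors of u and v. *)
Lemma vac_positive : psd_on predT (fun a b => vac isl K (rev (rev a ++ b)) [::]).
Proof.
move=> v _.
pose u := flatten [seq [seq (a.1 * p.1, p.2) | p <- fock_vector a.2] | a <- v].
have -> : kform (fun a b => vac isl K (rev (rev a ++ b)) [::]) v = kform fock_kernel u.
  rewrite /kform /u big_flatten big_map; apply: eq_bigr => a _.
  rewrite big_map; under [RHS]eq_bigr do rewrite big_flatten big_map.
  rewrite [RHS]exchange_big /=; apply: eq_bigr => b _.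
  rewrite rev_cat revK vac_cat big_distrr /=.
  under [RHS]eq_bigr do rewrite big_map /=.
  rewrite [RHS]exchange_big /= big_seq_cond [RHS]big_seq_cond.
  apply: eq_bigr => q /andP[qb _].
  rewrite vac_fock_vector; last exact: (allP (fock_vector_good _) _ qb).
  rewrite !big_distrr /=; apply: eq_bigr => p _.
  by rewrite rmorphM /=; ring.
apply: fock_kernel_psd; apply/allP => r /flattenP[l /mapP[a av ->]].
by move=> /mapP[p pa ->] /=; exact: (allP (fock_vector_good _) _ pa).
Qed.

End FockPositivity.

(** * Moments determine cumulants *)

Section WordMoments.
Context (I J : Type) (C : numClosedFieldType).

Section Letters.
Context (T : choiceType) (c : T -> I + J).
Implicit Types (K : seq T -> C) (w : seq T).

Definition wmoment K w : C := vac (left_letter c) K (rev w) [::].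

Lemma wmomentE n (f : 'I_n -> T) K :
  wmoment K [seq f k | k <- enum 'I_n] = moment_of c f K.
Proof. by rewrite moment_of_vac. Qed.

Lemma wmoment_tuple K w : wmoment K w = moment_of c (tnth (in_tuple w)) K.
Proof. by rewrite -wmomentE map_tnth_enum. Qed.

Lemma size_subword n (f : 'I_n -> T) V : size (subword f V) = #|V|.
Proof. by rewrite size_map -cardE. Qed.

Lemma moment_of_top n (f : 'I_n.+1 -> T) K :
  moment_of c f K = K [seq f k | k <- enum 'I_n.+1] +
    \sum_(pi in BNC (c \o f) | pi != [set [set: 'I_n.+1]])
      \prod_(V in pi) K (subword f V).
Proof.
rewrite /moment_of (bigD1 _ (BNC_top _ (ltn0Sn n))) /= big_set1; congr (K _ + _).
by rewrite /subword; congr map; apply: eq_enum => k; rewrite !inE.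
Qed.

Lemma BNC_block n (f : 'I_n.+1 -> T) pi (V : {set 'I_n.+1}) :
  pi \in BNC (c \o f) -> V \in pi -> pi != [set [set: 'I_n.+1]] ->
  (0 < #|V| < n.+1)%N.
Proof.
move=> piB Vpi piN; have /andP[/andP[V0]] := BNC_card piB Vpi.
by rewrite leq_eqVlt (negPf piN) implybF V0 => /orP[->|].
Qed.

Lemma eq_wmoment K1 K2 w : (forall u, u != [::] -> K1 u = K2 u) ->
  wmoment K1 w = wmoment K2 w.
Proof.
move=> K12; rewrite !wmoment_tuple; apply: eq_bigr => pi piB; apply: eq_bigr => V Vpi.
apply: K12; rewrite -size_eq0 size_subword cards_eq0.
exact: partition_neq0 (BNC_partition piB) Vpi.
Qed.

(** The one-block partition contributes K w, and all other blocks are shorter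
    non-empty words. *)
Lemma wmoment_inj K1 K2 : (forall w, wmoment K1 w = wmoment K2 w) ->
  forall w, w != [::] -> K1 w = K2 w.
Proof.
move=> H w; have [m] := ubnP (size w); elim: m w => // m IH w.
case: w => [//|x u]; set w := x :: u => wm _.
have := H w; rewrite !wmoment_tuple !moment_of_top !map_tnth_enum /=.
suff -> : \sum_(pi in BNC (c \o tnth (in_tuple w)) | pi != [set [set: 'I_(size u).+1]])
      \prod_(V in pi) K1 (subword (tnth (in_tuple w)) V) =
    \sum_(pi in BNC (c \o tnth (in_tuple w)) | pi != [set [set: 'I_(size u).+1]])
      \prod_(V in pi) K2 (subword (tnth (in_tuple w)) V) by move/addIr.
apply: eq_bigr => pi /andP[piB piN]; apply: eq_bigr => V Vpi.
have /andP[V0 Vn] := BNC_block piB Vpi piN.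
apply: IH; last by rewrite -size_eq0 size_subword -lt0n.
by rewrite size_subword; apply: leq_trans Vn _; rewrite -ltnS.
Qed.

End Letters.

Lemma wmoment_map (T T' : choiceType) (c : T' -> I + J) (g : T -> T') K w :
  wmoment c K (map g w) = wmoment (c \o g) (K \o map g) w.
Proof.
have -> : map g w = [seq (g \o tnth (in_tuple w)) k | k <- enum 'I_(size w)].
  by rewrite (map_comp g (tnth (in_tuple w))) map_tnth_enum.
rewrite [RHS]wmoment_tuple wmomentE.
rewrite /moment_of /=; apply: eq_bigr => pi _; apply: eq_bigr => V _ /=.
by rewrite /subword -map_comp.
Qed.

End WordMoments.

(** * Multilinearity by colouring letters *)

Section Lifts.

(** All the sequences obtained from [s] by choosing a lift of each entry; iterating
    the construction lifts lists of words. *)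
Fixpoint lifts (A B : Type) (g : A -> seq B) (s : seq A) : seq (seq B) :=
  if s is a :: s' then [seq b :: t | b <- g a, t <- lifts g s'] else [:: [::]].
Arguments lifts : simpl never.

Context (C : nmodType).

Lemma sum_lifts0 (A B : Type) (g : A -> seq B) (F : seq B -> C) :
  \sum_(t <- lifts g [::]) F t = F [::].
Proof. by rewrite big_seq1. Qed.

Lemma sum_lifts_cons (A B : Type) (g : A -> seq B) a s (F : seq B -> C) :
  \sum_(t <- lifts g (a :: s)) F t = \sum_(b <- g a) \sum_(t <- lifts g s) F (b :: t).
Proof. by rewrite big_allpairs_dep. Qed.

Lemma sum_lifts_rcons (A B : Type) (g : A -> seq B) a s (F : seq B -> C) :
  \sum_(t <- lifts g (rcons s a)) F t =
  \sum_(t <- lifts g s) \sum_(b <- g a) F (rcons t b).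
Proof.
elim: s F => [|a' s IH] F.
  rewrite [rcons _ _]/= sum_lifts_cons sum_lifts0.
  by apply: eq_bigr => b _; rewrite sum_lifts0.
rewrite rcons_cons !sum_lifts_cons; apply: eq_bigr => b _.
by rewrite IH.
Qed.

Lemma sum_lifts_rev (A B : Type) (g : A -> seq B) s (F : seq B -> C) :
  \sum_(t <- lifts g (rev s)) F (rev t) = \sum_(t <- lifts g s) F t.
Proof.
elim: s F => [|a s IH] F; first by rewrite !sum_lifts0.
rewrite rev_cons sum_lifts_rcons sum_lifts_cons exchange_big /=.
by apply: eq_bigr => b _; rewrite -IH; apply: eq_bigr => t _; rewrite rev_rcons.
Qed.

End Lifts.

Arguments lifts : simpl never.

Section Coloring.
Context (C : numClosedFieldType) (T : choiceType) (isl : T -> bool).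
Context (K : seq (T * bool) -> C).

Definition colors (x : T) : seq (T * bool) := [:: (x, false); (x, true)].

(** A coloured letter (x, e) stands for the variable of x in the family e, so the
    uncoloured letter stands for the sum of the two variables. *)
Definition uncolored (w : seq T) : C := \sum_(v <- lifts colors w) K v.

Let isl2 (x : T * bool) := isl x.1.

Lemma sum_step_left_lifts x s (G : seq (seq (T * bool)) -> C) :
  \sum_(e <- colors x) \sum_(t <- lifts (lifts colors) s)
    \sum_(p <- step_left K e t) p.1 * G p.2 =
  \sum_(p <- step_left uncolored x s) p.1 * \sum_(t <- lifts (lifts colors) p.2) G t.
Proof.
have sing (F : seq (T * bool) -> C) :
    \sum_(v <- lifts colors [:: x]) F v = \sum_(e <- colors x) F [:: e].
  by rewrite sum_lifts_cons; apply: eq_bigr => e _; rewrite sum_lifts0.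
rewrite /step_left; case: s => [|V s].
  rewrite [RHS]big_cons big_seq1 /= mul1r !sum_lifts0 sum_lifts_cons sing.
  rewrite /uncolored sing big_distrl -big_split /=; apply: eq_bigr => e _.
  by rewrite !sum_lifts0 !big_cons big_nil /= mul1r addr0.
set L := (X in X = _).
rewrite !big_cons big_nil addr0 /= !mul1r.
have -> : \sum_(t <- lifts (lifts colors) [:: [:: x], V & s]) G t =
    \sum_(e <- colors x) \sum_(v <- lifts colors V) \sum_(t <- lifts (lifts colors) s)
      G [:: [:: e], v & t].
  by rewrite sum_lifts_cons sing; apply: eq_bigr => e _; rewrite sum_lifts_cons.
have -> : uncolored [:: x] * \sum_(t <- lifts (lifts colors) (V :: s)) G t =
    \sum_(e <- colors x) \sum_(v <- lifts colors V) \sum_(t <- lifts (lifts colors) s)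
      K [:: e] * G (v :: t).
  rewrite /uncolored sing big_distrl; apply: eq_bigr => e _ /=.
  rewrite sum_lifts_cons big_distrr; apply: eq_bigr => v _ /=.
  by rewrite big_distrr.
have -> : \sum_(t <- lifts (lifts colors) ((x :: V) :: s)) G t =
    \sum_(e <- colors x) \sum_(v <- lifts colors V) \sum_(t <- lifts (lifts colors) s)
      G ((e :: v) :: t).
  by rewrite sum_lifts_cons sum_lifts_cons.
have -> : uncolored (x :: V) * \sum_(t <- lifts (lifts colors) s) G t =
    \sum_(e <- colors x) \sum_(v <- lifts colors V) \sum_(t <- lifts (lifts colors) s)
      K (e :: v) * G t.
  rewrite /uncolored sum_lifts_cons big_distrl; apply: eq_bigr => e _ /=.
  rewrite big_distrl; apply: eq_bigr => v _ /=.
  by rewrite big_distrr.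
rewrite {}/L -!big_split /=; apply: eq_bigr => e _.
rewrite sum_lifts_cons -!big_split /=; apply: eq_bigr => v _.
rewrite -!big_split /=; apply: eq_bigr => t _.
by rewrite !big_cons big_nil /= !mul1r addr0.
Qed.

(** Each step of the recursion consumes one letter and each letter ends up in one
    cumulant, so the sum over its colours can be carried out there. *)
Lemma sum_vac_lifts u s :
  \sum_(v <- lifts colors u) \sum_(t <- lifts (lifts colors) s) vac isl2 K v t =
  vac isl uncolored u s.
Proof.
elim: u s => [|x u IH] s.
  rewrite sum_lifts0; case: s => [|V s]; first by rewrite sum_lifts0.
  by rewrite sum_lifts_cons big1 // => v _; rewrite big1.
rewrite sum_lifts_cons /=.
pose G t := \sum_(v <- lifts colors u) vac isl2 K v t.
have GE s' : \sum_(t <- lifts (lifts colors) s') G t = vac isl uncolored u s'.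
  by rewrite -IH exchange_big.
transitivity (\sum_(e <- colors x) \sum_(t <- lifts (lifts colors) s)
    \sum_(p <- step isl2 K e t) p.1 * G p.2).
  apply: eq_bigr => e _; rewrite exchange_big /=; apply: eq_bigr => t _.
  rewrite exchange_big /=; apply: eq_bigr => p _.
  by rewrite big_distrr.
have stepE (e : T * bool) t : e \in colors x -> step isl2 K e t =
    if isl x then step_left K e t else [seq (p.1, rev p.2) | p <- step_left K e (rev t)].
  by rewrite !inE /step /isl2 => /orP[] /eqP ->.
rewrite [in RHS]/step big_seq_cond; under eq_bigr => e /andP[ex _].
  under eq_bigr do rewrite stepE //.
  over.
rewrite -big_seq_cond; case: ifP => _.
  rewrite sum_step_left_lifts; apply: eq_bigr => p _.
  by rewrite GE.
rewrite big_map.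
transitivity (\sum_(e <- colors x) \sum_(t <- lifts (lifts colors) (rev s))
    \sum_(p <- step_left K e t) p.1 * G (rev p.2)).
  apply: eq_bigr => e _; rewrite -[RHS]sum_lifts_rev revK; apply: eq_bigr => t _.
  by rewrite big_map.
rewrite (sum_step_left_lifts _ _ (fun t => G (rev t))); apply: eq_bigr => p _ /=.
by rewrite -GE -[in RHS]sum_lifts_rev revK.
Qed.

Lemma sum_lifts_mono (F : seq (T * bool) -> C) (e : bool) u :
  (forall v, ~~ all (fun y => y.2 == e) v -> F v = 0) ->
  \sum_(v <- lifts colors u) F v = F [seq (x, e) | x <- u].
Proof.
elim: u F => [|x u IH] F F0; first by rewrite sum_lifts0.
have zero e' : e' != e -> \sum_(v <- lifts colors u) F ((x, e') :: v) = 0.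
  by move=> ee'; rewrite big1// => v _; apply: F0; rewrite /= (negPf ee').
have IHe : \sum_(v <- lifts colors u) F ((x, e) :: v) = F [seq (y, e) | y <- x :: u].
  by rewrite (IH (fun v => F ((x, e) :: v))) // => v v0; apply: F0; rewrite /= eqxx.
rewrite sum_lifts_cons /colors !big_cons big_nil addr0.
by case: e zero IHe {IH F0} => zero ->; rewrite zero ?(addr0, add0r).
Qed.

(** Bi-freeness of the two families is the vanishing of [K] on these words. *)
Definition mixed (v : seq (T * bool)) : bool :=
  ~~ all (fun y => y.2) v && ~~ all (fun y => ~~ y.2) v.

Lemma uncolored_mixed0 u : (forall v, mixed v -> K v = 0) -> u != [::] ->
  uncolored u = K [seq (x, false) | x <- u] + K [seq (x, true) | x <- u].
Proof.
case: u => // x u K0 _.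
rewrite /uncolored sum_lifts_cons /colors !big_cons big_nil addr0.
have key e v : ~~ all (fun y : T * bool => y.2 == e) v -> K ((x, e) :: v) = 0.
  move=> ve; apply: K0; rewrite /mixed /=; case: e ve => /= ve.
    by rewrite andbT; apply: contra ve; apply: sub_all => y ->.
  by apply: contra ve; apply: sub_all => y /negPf->.
by rewrite (sum_lifts_mono u (key false)) (sum_lifts_mono u (key true)).
Qed.

End Coloring.

Lemma sum_wmoment_lifts (C : numClosedFieldType) (I J : choiceType)
    (K : seq ((I + J) * bool) -> C) (w : seq (I + J)) :
  \sum_(v <- lifts (@colors _) w) wmoment fst K v = wmoment id (uncolored K) w.
Proof.
rewrite /wmoment -sum_vac_lifts -sum_lifts_rev.
apply: eq_bigr => v _; rewrite revK sum_lifts0.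
by [].
Qed.

(** * The free algebra and its functionals *)

Section FreeAlgebra.

Lemma malg_scaleAr (K : monomType) (F : comNzRingType) (a : F) (x y : malg K F) :
  a *: (x * y) = x * (a *: y).
Proof.
apply/malgP => k.
rewrite mcoeffZ (mcoeffMlw _ (fsubset_refl _) (msuppZ_le a y)) mcoeffMl.
rewrite big_distrr; apply: eq_bigr => u _ /=.
rewrite big_distrr; apply: eq_bigr => v _ /=.
by rewrite mcoeffZ mulrnAr mulrCA.
Qed.

Context (R : realType) (T : choiceType).
Notation C := R[i].

(** A separate name for the monoid algebra of a free monoid, which can carry the
    algebra structure without competing with the one that monoid algebras of
    commutative monoids have. *)
Definition free_algebra : Type := malg (fmonom T) C.

HB.instance Definition _ := GRing.Lalgebra.on free_algebra.
HB.instance Definition _ :=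
  GRing.Lalgebra_isAlgebra.Build C free_algebra (@malg_scaleAr _ _).

Definition word (w : seq T) : malg (fmonom T) C := mkmalgU (FMonom w) 1.

Lemma malgU_word (a : C) (w : fmonom T) :
  mkmalgU w a = a *: word w.
Proof.
apply/malgP => k; rewrite mcoeffZ !mcoeffU fmK.
by case: eqP => _; rewrite ?mulr1n ?mulr1 ?mulr0n ?mulr0.
Qed.

Lemma malg_wordE (x : malg (fmonom T) C) :
  x = \sum_(w <- msupp x) mcoeff w x *: word w.
Proof. by rewrite [LHS]monalgE; apply: eq_bigr => w _; rewrite malgU_word. Qed.

Lemma word_mul u v : word u * word v = word (u ++ v).
Proof.
rewrite /word [LHS]fgmulUU mulr1; congr mkmalgU.
by rewrite /mmul /= fmmulE.
Qed.

Lemma word_nil : word [::] = 1.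
Proof. by rewrite /word -fmoneE. Qed.

Definition word_functional (m : seq T -> C) (x : malg (fmonom T) C) : C :=
  mmap idfun (fun w : fmonom T => m w) x.

Lemma word_functional_is_linear m : linear_for *%R (word_functional m).
Proof.
move=> a x y; rewrite /word_functional.
have L (z : malg (fmonom T) C) (d : {fset fmonom T}) : (msupp z `<=` d)%fset ->
    mmap idfun (fun w : fmonom T => m w) z = \sum_(w <- d) mcoeff w z * m w.
  by move=> zd; rewrite (mmapEw zd).
rewrite mmapD (L _ _ (msuppZ_le a x)) (L _ _ (fsubset_refl _)); congr (_ + _).
by rewrite big_distrr; apply: eq_bigr => w _; rewrite mcoeffZ /= mulrA.
Qed.

HB.instance Definition _ m :=
  GRing.isLinear.Build C (malg (fmonom T) C) C *%R (word_functional m)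
    (word_functional_is_linear m).

Lemma word_functionalE m w : word_functional m (word w) = m w.
Proof. by rewrite /word_functional /word (mmapU (f := idfun)) /= mul1r. Qed.

Lemma functional_ext (mu1 mu2 : {scalar malg (fmonom T) C}) :
  (forall w, mu1 (word w) = mu2 (word w)) -> mu1 =1 mu2.
Proof.
move=> H x; rewrite (malg_wordE x) !linear_sum; apply: eq_bigr => w _.
by rewrite !linearZ /= H.
Qed.

Definition free_functional m : {scalar free_algebra} :=
  (word_functional m : {scalar malg (fmonom T) C}).

Definition letter (x : T) : free_algebra := word [:: x].

Lemma prod_letter (w : seq T) : \prod_(x <- w) letter x = word w.
Proof.
elim: w => [|x w IH]; first by rewrite big_nil word_nil.
rewrite big_cons.
by rewrite [X in _ * X]IH; exact: (word_mul [:: x] w).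
Qed.

End FreeAlgebra.

(** * Bi-free convolution adds cumulants *)

Section CumulantsOfFamilies.
Context (R : realType) (I J : choiceType).
Notation C := R[i].
Context (T : choiceType) (c : T -> I + J).
Context (A : algType C) (phi : {scalar A}) (z : T -> A).

(** A family indexed by letters with faces makes bi-free cumulants functions of
    words. The letters may be coloured, which is how two families are handled at
    once. *)
Definition family_cumulant (w : seq T) : C :=
  bifree_cumulant phi (c \o tnth (in_tuple w)) (z \o tnth (in_tuple w)).

Lemma bifree_cumulantE n (f : 'I_n -> T) :
  bifree_cumulant phi (c \o f) (z \o f) = family_cumulant [seq f k | k <- enum 'I_n].
Proof.
have main (w : seq T) (e : n = size w) :
    (forall k, f k = tnth (in_tuple w) (cast_ord e k)) ->
    bifree_cumulant phi (c \o f) (z \o f) = family_cumulant w.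
  subst n => fE; rewrite /family_cumulant.
  suff -> : f = tnth (in_tuple w) by [].
  by apply/funext => k; rewrite fE cast_ord_id.
have sz : n = size [seq f k | k <- enum 'I_n] by rewrite size_map size_enum_ord.
apply: (main _ sz) => k.
rewrite (tnth_nth (f k)) /= (nth_map k) ?size_enum_ord//.
by congr f; apply: val_inj; rewrite /= nth_enum_ord.
Qed.

Lemma subword_restr n (f : 'I_n -> T) (V : {set 'I_n}) :
  [seq restr f V k | k <- enum 'I_#|V|] = subword f V.
Proof.
rewrite /restr /subword (map_comp f (@enum_val _ (mem V))); congr map.
case: (pickP (mem V)) => [x0 x0V|V0].
  apply: (@eq_from_nth _ x0); first by rewrite size_map size_enum_ord -cardE.
  move=> i; rewrite size_map size_enum_ord => iV.
  rewrite (nth_map (Ordinal iV)) ?size_enum_ord // (enum_val_nth x0).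
  by rewrite nth_enum_ord.
have cV : #|V| = 0%N by exact: eq_card0.
have sz s : size s = 0%N -> s = [::] :> seq 'I_n by case: s.
apply: (etrans (sz _ _) (esym (sz _ _))); last by rewrite -cardE.
by rewrite size_map size_enum_ord.
Qed.

Hypothesis phi1 : phi 1 = 1.

Lemma family_moment w :
  phi (\prod_(x <- w) z x) = wmoment c family_cumulant w.
Proof.
rewrite wmoment_tuple [in LHS]big_tnth.
have := moment_cumulant (c \o tnth (in_tuple w)) (z \o tnth (in_tuple w)) phi1.
move=> /= ->; apply: eq_bigr => pi _; apply: eq_bigr => V _.
by rewrite -(subword_restr (tnth (in_tuple w))) -bifree_cumulantE.
Qed.

Lemma family_cumulant_unique (K : seq T -> C) :
  (forall w, phi (\prod_(x <- w) z x) = wmoment c K w) ->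
  forall w, w != [::] -> family_cumulant w = K w.
Proof. by move=> H; apply: (@wmoment_inj _ _ _ _ c) => w; rewrite -family_moment. Qed.

End CumulantsOfFamilies.

Section Convolution.
Context (R : realType) (I J : choiceType).
Notation C := R[i].
Implicit Types (mu : {scalar ncpoly R I J}) (K : seq (I + J) -> C).

Definition has_cumulants mu K : Prop := forall w, mu (word _ w) = wmoment id K w.

Lemma has_cumulants_exists mu : mu 1 = 1 -> exists K, has_cumulants mu K.
Proof.
move=> mu1; pose phi := free_functional (fun w => mu (word R w)).
have phiE w : phi (\prod_(x <- w) letter R x) = mu (word R w).
  by rewrite prod_letter; exact: word_functionalE.
have phi1 : phi 1 = 1 by have := phiE [::]; rewrite big_nil word_nil mu1.
exists (family_cumulant id phi (@letter R _)) => w.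
by rewrite -family_moment.
Qed.

Lemma has_cumulants_unit mu K : has_cumulants mu K -> mu 1 = 1.
Proof. by move=> muK; rewrite -word_nil muK. Qed.

Lemma has_cumulants_inj mu K1 K2 : has_cumulants mu K1 -> has_cumulants mu K2 ->
  forall w, w != [::] -> K1 w = K2 w.
Proof.
by move=> H1 H2; apply: (@wmoment_inj _ _ _ _ id) => w; rewrite -H1 -H2.
Qed.

Lemma eq_has_cumulants mu K1 K2 : (forall w, w != [::] -> K1 w = K2 w) ->
  has_cumulants mu K1 -> has_cumulants mu K2.
Proof. by move=> K12 H w; rewrite H (eq_wmoment _ _ K12). Qed.

Lemma nceval_word (A : algType C) (z : I + J -> A) w :
  nceval z (word R w) = \prod_(k <- w) z k.
Proof. by rewrite /nceval /word (mmapU (f := in_alg A)) /= scale1r mul1r. Qed.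

Lemma distributionE (A : algType C) (phi : {scalar A}) (z : I + J -> A) Q :
  Defs.distribution phi z Q = word_functional (fun w => phi (\prod_(k <- w) z k)) Q.
Proof.
rewrite /Defs.distribution /nceval /word_functional /mmap linear_sum.
by apply: eq_bigr => w _; rewrite /= mulr_algl linearZ.
Qed.

Lemma distribution_eqP (A : algType C) (phi : {scalar A}) (z : I + J -> A) mu :
  mu =1 Defs.distribution phi z <-> forall w, mu (word R w) = phi (\prod_(k <- w) z k).
Proof.
split=> [H w|H Q]; first by rewrite H /Defs.distribution nceval_word.
rewrite distributionE; apply: functional_ext => w; rewrite H.
exact/esym/word_functionalE.
Qed.

Lemma prod_lifts (A : algType C) (z1 z2 : I + J -> A) (w : seq (I + J)) :
  \prod_(k <- w) (z1 k + z2 k) =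
  \sum_(v <- lifts (@colors _) w) \prod_(y <- v) (if y.2 then z2 y.1 else z1 y.1).
Proof.
elim: w => [|x w IH]; first by rewrite sum_lifts0 !big_nil.
rewrite big_cons IH sum_lifts_cons 2!big_cons big_nil addr0 /=.
rewrite mulrDl !big_distrr.
by congr (_ + _); apply: eq_bigr => v _; rewrite big_cons.
Qed.

Section SumOfCumulants.
Context (A : algType C) (phi : {scalar A}) (z1 z2 : I + J -> A).
Hypothesis phi1 : phi 1 = 1.

Let z (y : (I + J) * bool) : A := if y.2 then z2 y.1 else z1 y.1.
Let K := family_cumulant fst phi z.

Lemma bifree_mixed0 : bifree phi z1 z2 <-> forall v, mixed v -> K v = 0.
Proof.
split=> [H v /andP[/allPn[y yv y2] /allPn[y' y'v y'2]]|H n chi eps n2 [i [j ij]]].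
  rewrite /K /family_cumulant.
  apply: (H (size v) _ (fun k => (tnth (in_tuple v) k).2)).
    move: yv y'v y2 y'2; case: v => [//|a [|b v]] //.
    by rewrite !inE => /eqP -> /eqP -> /negPf ->.
  move: yv y'v => /(tnthP (in_tuple v)) [i iE] /(tnthP (in_tuple v)) [j jE].
  by exists i, j; rewrite -iE -jE (negPf y2); apply: contra y'2 => /eqP <-.
pose f k := (chi k, eps k).
rewrite (_ : bifree_cumulant _ _ _ = bifree_cumulant phi (fst \o f) (z \o f)) //.
rewrite bifree_cumulantE; apply: H.
have mem k : f k \in [seq f k | k <- enum 'I_n] by rewrite map_f ?mem_enum.
rewrite /mixed; apply/andP; split; apply/allPn.
  by move: ij; case Ei : (eps i); case Ej : (eps j) => // _;
    [exists (f j)|exists (f i)]; rewrite ?mem //= ?Ei ?Ej.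
by move: ij; case Ei : (eps i); case Ej : (eps j) => // _;
  [exists (f i)|exists (f j)]; rewrite ?mem //= ?Ei ?Ej.
Qed.

Lemma wmoment_color (e : bool) w :
  phi (\prod_(k <- w) (if e then z2 k else z1 k)) =
  wmoment id (K \o map (fun x => (x, e))) w.
Proof.
have := wmoment_map (@fst (I + J) bool) (fun x => (x, e)) K w.
by rewrite /K -family_moment // big_map => ->.
Qed.

Lemma wmoment_sum w :
  phi (\prod_(k <- w) (z1 k + z2 k)) = wmoment id (uncolored K) w.
Proof.
rewrite prod_lifts linear_sum -sum_wmoment_lifts; apply: eq_bigr => v _.
exact: family_moment.
Qed.

End SumOfCumulants.

(** In the mixed family the cumulants of the sum are those of all the colourings,
    of which only the two constant ones survive. *)
Lemma conv_cumulants mu1 mu2 mu K1 K2 : bifree_conv mu1 mu2 mu ->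
  has_cumulants mu1 K1 -> has_cumulants mu2 K2 ->
  has_cumulants mu (fun w => K1 w + K2 w).
Proof.
move=> [A [phi [z1 [z2 [phi1 free]]]]].
move=> /distribution_eqP E1 /distribution_eqP E2 /distribution_eqP E H1 H2 w.
rewrite E wmoment_sum //; apply: eq_wmoment => u u0.
rewrite uncolored_mixed0 //; last exact/bifree_mixed0.
set K := family_cumulant _ _ _.
have E1' : has_cumulants mu1 (K \o map (fun x => (x, false))).
  by move=> v; rewrite E1; exact: (wmoment_color z1 z2 phi1 false).
have E2' : has_cumulants mu2 (K \o map (fun x => (x, true))).
  by move=> v; rewrite E2; exact: (wmoment_color z1 z2 phi1 true).
by rewrite -(has_cumulants_inj E1' H1 u0) -(has_cumulants_inj E2' H2 u0).
Qed.

(** The joint law of the two bi-free families is defined on the free algebra in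
    coloured letters by letting all mixed cumulants vanish. *)
Lemma cumulants_conv mu1 mu2 mu K1 K2 :
  has_cumulants mu1 K1 -> has_cumulants mu2 K2 ->
  has_cumulants mu (fun w => K1 w + K2 w) -> bifree_conv mu1 mu2 mu.
Proof.
move=> H1 H2 H.
pose K (v : seq ((I + J) * bool)) : C :=
  if all (fun y => y.2) v then K2 (map fst v)
  else if all (fun y => ~~ y.2) v then K1 (map fst v) else 0.
pose phi := free_functional (wmoment fst K).
pose z1 (k : I + J) := letter R (k, false) : free_algebra R _.
pose z2 (k : I + J) := letter R (k, true) : free_algebra R _.
pose z (y : (I + J) * bool) := if y.2 then z2 y.1 else z1 y.1.
have zE y : z y = letter R y by case: y => k [].
have phiE w : phi (\prod_(y <- w) z y) = wmoment fst K w.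
  under eq_bigr do rewrite zE.
  by rewrite prod_letter; exact: word_functionalE.
have phi1 : phi 1 = 1 by have := phiE [::]; rewrite big_nil.
have KE := family_cumulant_unique phi1 phiE.
have Kcol (e : bool) w : w != [::] -> family_cumulant fst phi z (map (fun x => (x, e)) w) =
    if e then K2 w else K1 w.
  move=> w0; rewrite KE; last by case: (w) w0.
  rewrite /K !all_map -map_comp map_id_in //.
  case: e; first by rewrite (eq_all (a2 := predT)) ?all_predT.
  rewrite (eq_all (a2 := predT) (fun _ => erefl true)) all_predT.
  by case: (w) w0.
have mix v : mixed v -> family_cumulant fst phi z v = 0.
  move=> mv; rewrite KE; last by case: (v) mv.
  by move: mv; rewrite /K /mixed => /andP[/negPf-> /negPf->].
exists (free_algebra R _), phi, z1, z2; split=> //.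
- exact/bifree_mixed0.
- apply/distribution_eqP => w; rewrite H1.
  rewrite [RHS](wmoment_color z1 z2 phi1 false); apply: eq_wmoment => u u0.
  by rewrite /= (Kcol false).
- apply/distribution_eqP => w; rewrite H2.
  rewrite [RHS](wmoment_color z1 z2 phi1 true); apply: eq_wmoment => u u0.
  by rewrite /= (Kcol true).
- apply/distribution_eqP => w; rewrite H wmoment_sum //; apply: eq_wmoment => u u0.
  by rewrite uncolored_mixed0 // (Kcol false) // (Kcol true).
Qed.

Lemma conv_pow_cumulants mu N nu K : bifree_conv_pow mu N nu ->
  has_cumulants mu K -> has_cumulants nu (fun w => N%:R * K w).
Proof.
move=> H HK; elim: H => [nu' E|n rho nu' _ IH conv].
  move=> w; rewrite E HK; apply: eq_wmoment => u _.
  by rewrite mul1r.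
apply: eq_has_cumulants (conv_cumulants conv IH HK) => w _.
by rewrite -[n.+1]addn1 natrD mulrDl mul1r.
Qed.

End Convolution.

(** * Positivity as a condition on the moment kernel *)

Section Positivity.
Context (R : realType) (I J : choiceType).
Notation C := R[i].
Notation letters := (I + J)%type.
Implicit Types (nu mu : {scalar ncpoly R I J}) (K : seq letters -> C).

Definition moment_kernel nu (u v : seq letters) : C := nu (word R (rev u ++ v)).

Lemma ncstar_coeff (Q : ncpoly R I J) (w : seq letters) :
  mcoeff (FMonom w) (ncstar Q) = (mcoeff (FMonom (rev w)) Q)^*.
Proof.
rewrite /ncstar raddf_sum /=.
under eq_bigr do rewrite mcoeffU.
have revE (u : fmonom letters) : (FMonom (rev u) == FMonom w) = (u == FMonom (rev w)).
  by rewrite !fmP /= (can2_eq revK revK).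
under eq_bigr do rewrite revE.
have [win|wout] := boolP (FMonom (rev w) \in msupp Q).
  rewrite (bigD1_seq _ win) ?fset_uniq //= eqxx mulr1n big1 ?addr0// => u /negPf ->.
  by rewrite mulr0n.
rewrite big_seq_cond big1 ?mcoeff_outdom ?rmorph0 // => u /andP[uQ _].
by case: eqP => // E; move: wout; rewrite -E uQ.
Qed.

Lemma ncstar_word_sum (v : seq (C * seq letters)) :
  ncstar (\sum_(p <- v) p.1 *: word R p.2) =
  \sum_(p <- v) p.1^* *: word R (rev p.2) :> ncpoly R I J.
Proof.
apply/malgP => w; rewrite -(fmK w) ncstar_coeff !raddf_sum /=.
apply: eq_bigr => p _; rewrite !mcoeffZ !mcoeffU1 rmorphM rmorph_nat.
by rewrite !fmP /= (can2_eq revK revK).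
Qed.

Lemma malg_word_list (Q : ncpoly R I J) :
  exists v : seq (C * seq letters), Q = \sum_(p <- v) p.1 *: word R p.2.
Proof.
exists [seq (mcoeff w Q, w : seq letters) | w <- msupp Q].
by rewrite big_map; exact: malg_wordE.
Qed.

Lemma moment_kform nu (v : seq (C * seq letters)) :
  let Q := \sum_(p <- v) p.1 *: word R p.2 : ncpoly R I J in
  nu (ncstar Q * Q) = kform (moment_kernel nu) v.
Proof.
move=> Q; rewrite ncstar_word_sum /Q big_distrl linear_sum /kform /=.
apply: eq_bigr => p _; rewrite big_distrr linear_sum /=; apply: eq_bigr => q _.
rewrite -malg_scaleAr -scalerAl word_mul !linearZ /= /moment_kernel.
by rewrite mulrCA mulrA.
Qed.

Lemma Sigma_plusP nu :
  Sigma_plus nu <-> nu 1 = 1 /\ psd_on predT (moment_kernel nu).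
Proof.
split=> -[nu1 nuP]; split=> //.
  by move=> v _; rewrite -moment_kform.
move=> Q; have [v ->] := malg_word_list Q.
by rewrite moment_kform; apply: nuP; exact: all_predT.
Qed.

End Positivity.

(** * Cumulants of infinitely divisible laws *)

Section Estimates.
Context (I J : Type) (C : numClosedFieldType) (T : choiceType) (c : T -> I + J).

Lemma BNC_card_ge2 n (f : 'I_n.+1 -> T) (pi : {set {set 'I_n.+1}}) :
  pi \in BNC (c \o f) -> pi != [set [set: 'I_n.+1]] -> (1 < #|pi|)%N.
Proof.
move=> piB; have piP := BNC_partition piB; apply: contraR; rewrite -leqNgt => pi1.
have [V Vpi _] : exists2 V, V \in pi & ord0 \in V.
  by apply/bigcupP; rewrite -/(cover pi) (cover_partition piP) inE.
have piE : pi = [set V].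
  apply/eqP; rewrite eq_sym eqEcard sub1set Vpi cards1.
  exact: pi1.
by have := cover_partition piP; rewrite piE /cover big_set1 => ->.
Qed.

(** Scaling the cumulants by [a] multiplies the contribution of a partition by [a]
    to the number of its blocks, which is at least 2 except for the one-block
    partition. *)
Lemma wmoment_scale_bound (K : seq T -> C) w : w != [::] ->
  exists2 M : C, 0 <= M & forall a : C, `|a| <= 1 ->
    `|wmoment c (fun u => a * K u) w - a * K w| <= M * `|a| ^+ 2.
Proof.
case: w => // x u _; set w := x :: u.
pose P (pi : {set {set 'I_(size u).+1}}) := \prod_(V in pi) K (subword (tnth (in_tuple w)) V).
exists (\sum_(pi in BNC (c \o tnth (in_tuple w)) | pi != [set [set: 'I_(size u).+1]]) `|P pi|).
  by apply: sumr_ge0 => pi _; exact: normr_ge0.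
move=> a a1; rewrite wmoment_tuple moment_of_top map_tnth_enum addrC addKr.
rewrite mulr_suml; apply: (le_trans (ler_norm_sum _ _ _)); apply: ler_sum => pi /andP[piB piN].
rewrite big_split /= prodr_const normrM mulrC ler_wpM2l ?normr_ge0// normrX.
by rewrite ler_wiXn2l ?normr_ge0 //; exact: BNC_card_ge2 piB piN.
Qed.

End Estimates.

Section Limits.
Context (R : realType).
Notation C := R[i].

Lemma archimedean_le0 (r b : R) : (forall N : nat, (0 < N)%N -> r <= b / N%:R) -> r <= 0.
Proof.
move=> H; rewrite leNgt; apply/negP => r0.
have b0 : 0 <= b by have := H 1%N isT; rewrite divr1; apply/le_trans/ltW.
have := H (Num.bound (b / r)).+1 isT.
rewrite ler_pdivlMr ?ltr0n // mulrC -ler_pdivlMr //.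
apply/negP; rewrite -ltNge; apply: lt_trans (archi_boundP _) _.
  by rewrite divr_ge0// ltW.
by rewrite ltr_nat.
Qed.

(** Nonnegative numbers are the fixed points of the norm, and both sides of
    |z| = z are approximated. *)
Lemma ge0_of_approx (z B : C) : 0 <= B ->
  (forall N : nat, (0 < N)%N -> exists2 y : C, 0 <= y & `|y - z| <= B / N%:R) ->
  0 <= z.
Proof.
move=> B0 H.
have realE (x : C) : 0 <= x -> x = (complex.Re x)%:C%C.
  by move=> /ger0_real/RRe_real.
have d0 : 0 <= `| `|z| - z| by exact: normr_ge0.
have : complex.Re `| `|z| - z| <= 0.
  apply: (@archimedean_le0 _ (complex.Re B * 2)) => N N0.
  have -> : complex.Re B * 2 / N%:R = complex.Re (B * 2 / N%:R).
    apply: complexI; rewrite -realE ?mulr_ge0 ?invr_ge0 //.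
    by rewrite !rmorphM /= fmorphV !rmorph_nat -realE.
  rewrite -lecR -!realE ?mulr_ge0 ?invr_ge0 //.
  have [y y0 yz] := H N N0.
  rewrite mulrAC mulr_natr mulr2n.
  apply: le_trans (ler_distD y _ _) _; apply: lerD; last exact: yz.
  apply: le_trans (yz); rewrite -{1}(ger0_norm y0) (distrC y).
  exact: ler_dist_dist.
rewrite -lecR -realE // => d0'.
have /eqP : `| `|z| - z| == 0 by rewrite eq_le d0 andbT.
by move=> /normr0_eq0/eqP; rewrite subr_eq0 => /eqP <-.
Qed.

End Limits.

Section InfinitelyDivisible.
Context (R : realType) (I J : choiceType).
Notation C := R[i].
Notation letters := (I + J)%type.
Implicit Types (nu mu : {scalar ncpoly R I J}) (K : seq letters -> C).

(** The bi-free cumulants of an infinitely divisible law are conditionally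
    positive: they are the limits of N times the moments of its N-th roots. *)
Lemma infdiv_cumulants_psd nu K : bifree_infdiv nu -> has_cumulants nu K ->
  psd_on (fun u => u != [::]) (block_kernel K).
Proof.
move=> nuID nuK v v0.
have bound w : exists M : C, 0 <= M /\ (w != [::] -> forall a : C, `|a| <= 1 ->
    `|wmoment id (fun u => a * K u) w - a * K w| <= M * `|a| ^+ 2).
  have [w0|w0] := eqVneq w [::]; first by exists 0.
  by have [M M0 MP] := @wmoment_scale_bound _ _ _ _ id K _ w0; exists M; split.
(* M w controls the word w for every a; it is used at a = 1 / N. *)
have [M MP] := choice bound.
pose W (p q : C * seq letters) := rev p.2 ++ q.2.
apply: (@ge0_of_approx _ _ (\sum_(p <- v) \sum_(q <- v) `|p.1^* * q.1| * M (W p q))).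
  by apply: sumr_ge0 => p _; apply: sumr_ge0 => q _; rewrite mulr_ge0 //; case: (MP (W p q)).
move=> N N0; have N0' : 0 < N%:R :> C by rewrite ltr0n.
have Nn : N%:R != 0 :> C by rewrite gt_eqF.
have [mu /Sigma_plusP[mu1 muP] pow] := nuID N N0.
have [K' muK'] := has_cumulants_exists mu1.
have K'E u : u != [::] -> K' u = N%:R^-1 * K u.
  move=> u0; rewrite -(has_cumulants_inj (conv_pow_cumulants pow muK') nuK u0).
  by rewrite mulKf.
have muE := eq_has_cumulants K'E muK'.
exists (N%:R * kform (moment_kernel mu) v).
  apply: mulr_ge0; first exact: ltW.
  by apply: muP; exact: all_predT.
rewrite /kform big_distrr /= -sumrB mulr_suml.
apply: le_trans (ler_norm_sum _ _ _) _; rewrite big_seq_cond [leRHS]big_seq_cond.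
apply: ler_sum => p /andP[pv _]; rewrite big_distrr /= -sumrB mulr_suml.
apply: le_trans (ler_norm_sum _ _ _) _; rewrite big_seq_cond [leRHS]big_seq_cond.
apply: ler_sum => q /andP[qv _].
rewrite mulrCA -mulrBr normrM -mulrA ler_wpM2l ?normr_ge0//.
rewrite /moment_kernel /block_kernel muE -/(W p q).
have Wn : W p q != [::].
  by rewrite -size_eq0 size_cat addn_eq0 negb_and orbC size_eq0 (allP v0 _ qv).
have N1 : `|N%:R^-1 : C| <= 1.
  by rewrite normfV normr_nat invf_le1 // ler1n.
have [_ /(_ Wn _ N1)] := MP (W p q).
move=> /(ler_wpM2l (ltW N0')).
set m := wmoment _ _ _; rewrite (_ : N%:R * m - _ = N%:R * (m - N%:R^-1 * K (W p q))).
  by rewrite normrM normr_nat normfV normr_nat (mulrCA _ (M _)) expr2 mulVKf.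
by rewrite mulrBr mulVKf.
Qed.

Lemma cumulant_letter nu K x : has_cumulants nu K -> K [:: x] = nu (word R [:: x]).
Proof.
move=> ->; rewrite /wmoment /= /step /step_left.
case: ifP => _; rewrite ?big_map /= !big_cons big_nil /=.
  by rewrite mulr0 add0r addr0 mulr1.
by rewrite mulr0 add0r addr0 mulr1.
Qed.

Definition scaled_law K (a : C) : {scalar ncpoly R I J} :=
  word_functional (wmoment id (fun w => a * K w)).

Lemma scaled_law_cumulants K a : has_cumulants (scaled_law K a) (fun w => a * K w).
Proof. by move=> w; exact: word_functionalE. Qed.

(** Only K [:: x] is not covered by the conditional positivity; it is a moment of a
    positive functional, hence real. *)
Lemma scaled_law_positive nu K a : Sigma_plus nu -> bifree_infdiv nu ->
  has_cumulants nu K -> 0 <= a -> Sigma_plus (scaled_law K a).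
Proof.
move=> /Sigma_plusP[_ nuP] nuID nuK a0; apply/Sigma_plusP; split.
  exact: has_cumulants_unit (scaled_law_cumulants K a).
have -> : moment_kernel (scaled_law K a) = fun u v =>
    vac (left_letter id) (fun w => a * K w) (rev (rev u ++ v)) [::].
  by apply/funext => u; apply/funext => v; rewrite /moment_kernel scaled_law_cumulants.
apply: vac_positive => [v v0|x].
  rewrite (_ : kform _ _ = a * kform (block_kernel K) v).
    by rewrite mulr_ge0 // (infdiv_cumulants_psd nuID nuK).
  rewrite /kform big_distrr; apply: eq_bigr => p _; rewrite big_distrr.
  by apply: eq_bigr => q _; rewrite /block_kernel /= mulrCA.
rewrite rmorphM /= (cumulant_letter _ nuK) conj_Creal ?ger0_real//; congr (_ * _).
have := psd_on_hermitian (x := [::]) (y := [:: x]) nuP isT isT.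
by rewrite /moment_kernel /= => <-.
Qed.

Lemma delta0E (Q : ncpoly R I J) :
  delta0 Q = word_functional (fun w => (w == [::])%:R) Q.
Proof.
rewrite /delta0 /nceval /word_functional /mmap; apply: eq_bigr => w _.
rewrite /= mulr_algl; congr (_ * _).
by case: (w : seq letters) => [|x u]; rewrite ?big_nil ?big_cons ?mul0r.
Qed.

End InfinitelyDivisible.

(** * The convolution semigroup *)

Section Semigroup.
Context (R : realType) (I J : choiceType).
Notation C := R[i].
Notation letters := (I + J)%type.
Implicit Types (nu mu : {scalar ncpoly R I J}) (K : seq letters -> C).

Lemma wmoment_nil K : wmoment id K [::] = 1.
Proof. by []. Qed.

Lemma scaled_law_bound K Q : exists2 M : C, 0 <= M & forall a : C, `|a| <= 1 ->
  `|scaled_law K a Q - delta0 Q| <= M * `|a|.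
Proof.
have bound w : exists M : C, 0 <= M /\ forall a : C, `|a| <= 1 ->
    `|wmoment id (fun u => a * K u) w - (w == [::])%:R| <= M * `|a|.
  have [->|w0] := eqVneq w [::].
    by exists 0; split=> // a _; rewrite wmoment_nil subrr normr0 mul0r.
  have [M M0 MP] := @wmoment_scale_bound _ _ _ _ id K _ w0.
  exists (M + `|K w|); split=> [|a a1]; first by rewrite addr_ge0.
  rewrite subr0 -(subrK (a * K w) (wmoment _ _ _)) mulrDl.
  apply: le_trans (ler_normD _ _) _; apply: lerD; last by rewrite normrM mulrC.
  apply: le_trans (MP _ a1) _; rewrite ler_wpM2l // expr2.
  by rewrite ler_piMr.
have [M MP] := choice bound.
exists (\sum_(w <- msupp Q) `|mcoeff w Q| * M w).
  by apply: sumr_ge0 => w _; rewrite mulr_ge0//; case: (MP w).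
move=> a a1; rewrite delta0E /scaled_law /word_functional /= /mmap -sumrB mulr_suml.
apply: le_trans (ler_norm_sum _ _ _) _; apply: ler_sum => w _.
rewrite -mulrBr normrM -mulrA ler_wpM2l //.
by have [_] := MP w; apply.
Qed.

Local Open Scope classical_set_scope.

Lemma scaled_law_cvg K Q :
  (scaled_law K t%:C%C Q : C^o) @[t --> (0 : R)^'+] --> (delta0 Q : C^o).
Proof.
have [M M0 MP] := scaled_law_bound K Q.
have ME : M = (complex.Re M)%:C%C by rewrite RRe_real // ger0_real.
have m0 : 0 <= complex.Re M by rewrite -ler0c -ME.
apply/cvgrPdist_lt => e e0.
have eE : e = (complex.Re e)%:C%C by rewrite RRe_real // ger0_real // ltW.
have re0 : 0 < complex.Re e by rewrite -ltcR -eE.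
near=> t.
have t0 : 0 < t by near: t; exact: nbhs_right_gt.
have tn : `|t%:C%C : C| = t%:C%C by rewrite ger0_norm // ler0c ltW.
rewrite distrC; apply: le_lt_trans (MP _ _) _.
  rewrite tn -[1]/((1 : R)%:C%C) lecR.
  by near: t; exact: nbhs_right_le.
rewrite tn ME eE -rmorphM /= ltcR.
apply: le_lt_trans (_ : _ <= (complex.Re M + 1) * t) _.
  by rewrite ler_wpM2r ?(ltW t0) // lerDl.
rewrite mulrC -ltr_pdivlMr; last by rewrite ltr_wpDl.
near: t; apply: nbhs_right_lt.
by rewrite divr_gt0 // ltr_wpDl.
Unshelve. all: by end_near.
Qed.

Lemma eq_bifree_conv mu1 mu2 mu mu' : mu =1 mu' ->
  bifree_conv mu1 mu2 mu -> bifree_conv mu1 mu2 mu'.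
Proof.
move=> E [A [phi [z1 [z2 [phi1 free E1 E2 E3]]]]].
exists A, phi, z1, z2; split=> // Q.
by rewrite -E E3.
Qed.

Lemma scaled_law_conv K a b :
  bifree_conv (scaled_law K a) (scaled_law K b) (scaled_law K (a + b)).
Proof.
apply: cumulants_conv (scaled_law_cumulants K a) (scaled_law_cumulants K b) _.
by apply: eq_has_cumulants (scaled_law_cumulants K (a + b)) => w _; rewrite mulrDl.
Qed.

Lemma semigroup_infdiv nu (nu_ : R -> {scalar ncpoly R I J}) :
  (forall t, 0 <= t -> Sigma_plus (nu_ t)) ->
  (forall s t, 0 <= s -> 0 <= t -> bifree_conv (nu_ s) (nu_ t) (nu_ (s + t))) ->
  nu_ 1 =1 nu -> bifree_infdiv nu.
Proof.
move=> pos conv nu1 N N0; pose h : R := N%:R^-1.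
have h0 : 0 <= h by rewrite invr_ge0.
exists (nu_ h); first exact: pos.
have pow k : bifree_conv_pow (nu_ h) k.+1 (nu_ (k.+1%:R * h)).
  elim: k => [|k IH]; first by apply: bifree_conv_pow1 => Q; rewrite mul1r.
  apply: bifree_conv_powS IH _.
  rewrite -[k.+2]addn1 natrD mulrDl mul1r.
  by apply: conv => //; rewrite mulr_ge0.
case: N N0 @h h0 pow => // n _ h h0 pow.
have E : n.+1%:R * h = 1 by rewrite mulfV // pnatr_eq0.
case: n @h h0 pow E => [|n] h h0 pow E.
  by apply: bifree_conv_pow1 => Q; rewrite -nu1 -E mul1r.
(* The last convolution must produce nu itself, which only agrees with nu_ 1
   pointwise. *)
apply: bifree_conv_powS (pow n) _.
apply: eq_bifree_conv nu1 _.
have E1 : n.+1%:R * h + h = 1.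
  by rewrite -[RHS]E -[n.+2]addn1 natrD mulrDl mul1r.
have := conv (n.+1%:R * h) h; rewrite E1; apply=> //.
by rewrite mulr_ge0.
Qed.

End Semigroup.

Local Open Scope classical_set_scope.

Theorem theorem3p4 (R : realType) (I J : choiceType)
    (nu : {scalar ncpoly R I J}) (nuP : Sigma_plus nu) :
  bifree_infdiv nu <->
  exists nu_ : R -> {scalar ncpoly R I J},
    [/\ forall t : R, 0 <= t -> Sigma_plus (nu_ t),
        forall s t : R, 0 <= s -> 0 <= t ->
          bifree_conv (nu_ s) (nu_ t) (nu_ (s + t)),
        nu_ 1 =1 nu,
        nu_ 0 =1 @delta0 R I J &
        forall Q : ncpoly R I J,
          (nu_ t Q : R[i]^o) @[t --> 0^'+] --> (delta0 Q : R[i]^o)].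
Proof.
split=> [nuID|[nu_ [pos conv nu1 _ _]]]; last exact: semigroup_infdiv pos conv nu1.
have [nu1 _] := nuP; have [K nuK] := has_cumulants_exists nu1.
exists (fun t : R => scaled_law K t%:C%C); split.
- by move=> t t0; apply: scaled_law_positive nuP nuID nuK _; rewrite ler0c.
- by move=> s t _ _; rewrite rmorphD; exact: scaled_law_conv.
- apply: functional_ext => w; rewrite nuK scaled_law_cumulants.
  by apply: eq_wmoment => u _; rewrite mul1r.
- move=> Q; have [M _ /(_ 0)] := scaled_law_bound K Q.
  by rewrite normr0 mulr0 normr_le0 subr_eq0 => /(_ ler01) /eqP.
- exact: scaled_law_cvg.
Qed.
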